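(* The following problem is $W[1]$-hard parameterized by $k$: given a CSP instance $I$ with variable-constraint incidence graph $G$, and an interval bigraph $G'$ obtained from $G$ by adding at most $k$ edges to each constraint vertex, decide whether $I$ is satisfiable.
   Context: A CSP instance consists of a finite set of variables, a finite domain of values (part of the input, of unbounded size), and a finite set of constraints, each consisting of a tuple of variables (its scope) and a relation over the domain specifying the allowed tuples of values, listed explicitly. The instance is satisfiable if values can be assigned to the variables so that all constraints are satisfied. The variable-constraint incidence graph is the bipartite graph with the constraints on one side and the variables on the other, with an edge between a constraint and each variable in its scope. A bipartite graph is an interval bigraph if every vertex can be assigned an interval on the real line such that two vertices from different sides are adjacent if and only if their intervals intersect. Added edges join constraint vertices to variable vertices. *)

(* Defs.v *)
From HB Require Import structures.
From mathcomp Require Import all_boot all_order all_algebra.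
From mathcomp Require Import reals.

Set Implicit Arguments.
Unset Strict Implicit.
Unset Printing Implicit Defensive.

(** * Machine model

    Multi-stack machines over the alphabet [bool] with structured control.
    Every basic step touches only the top of one stack.  Two stacks hold the
    two halves of a Turing tape, and a stack is a tape whose head stays at its
    end, so running times agree with those of multi-tape Turing machines up to
    a constant factor depending on the machine only. *)

Definition store := nat -> seq bool.

Definition upd (s : store) (r : nat) (w : seq bool) : store :=
  fun i => if i == r then w else s i.

Inductive prog :=
  | Skip
  | Push of nat & bool
  | Seq of prog & prog
  | Case of nat & prog & prog & prog
      (* pop the stack, branch on: empty / popped true / popped false *)
  | While of nat & prog.
      (* iterate as long as the stack is nonempty *)

(* [exec p s t s']: started on [s], [p] halts after [t] steps in [s']. *)
Inductive exec : prog -> store -> nat -> store -> Prop :=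
  | ExecSkip s : exec Skip s 1 s
  | ExecPush r b s : exec (Push r b) s 1 (upd s r (b :: s r))
  | ExecSeq p q s1 s2 s3 t u :
      exec p s1 t s2 -> exec q s2 u s3 -> exec (Seq p q) s1 (t + u) s3
  | ExecCaseNil r pe pt pf s t s' :
      s r = [::] -> exec pe s t s' -> exec (Case r pe pt pf) s t.+1 s'
  | ExecCaseTrue r pe pt pf s w t s' :
      s r = true :: w -> exec pt (upd s r w) t s' ->
      exec (Case r pe pt pf) s t.+1 s'
  | ExecCaseFalse r pe pt pf s w t s' :
      s r = false :: w -> exec pf (upd s r w) t s' ->
      exec (Case r pe pt pf) s t.+1 s'
  | ExecWhileNil r p s : s r = [::] -> exec (While r p) s 1 s
  | ExecWhileCons r p s1 s2 s3 t u :
      s1 r <> [::] -> exec p s1 t s2 -> exec (While r p) s2 u s3 ->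
      exec (While r p) s1 (t + u).+1 s3.

Definition unary (n : nat) : seq bool := nseq n true.

Definition init (x y : seq bool) : store :=
  fun r => match r with 0 => x | 1 => y | _ => [::] end.

Definition computable (f : nat -> nat) : Prop :=
  exists p, forall n, exists t s,
    exec p (init (unary n) [::]) t s /\ s 0 = unary (f n).

(** * Parameterized problems and fpt-reductions *)

(* A problem "given an X, decide whether Y" with parameter k: [instance x k]
   says that the string [x] with parameter [k] describes an X, and [positive]
   that it moreover satisfies Y.  An ordinary language has every pair as an
   instance.  Reductions are required to output genuine instances. *)
Record pproblem := PProblem {
  instance : seq bool -> nat -> Prop;
  positive : seq bool -> nat -> Prop
}.

(* [enc] is meant to be injective. *)
Definition encoded_problem (T : Type) (enc : T -> seq bool)
    (ok yes : T -> nat -> Prop) : pproblem :=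
  {| instance x k := exists y, x = enc y /\ ok y k;
     positive x k := exists y, [/\ x = enc y, ok y k & yes y k] |}.

(* Many-one reductions running in time f(k) * poly(|x|) with new parameter at
   most g(k), for computable f and g.  The parameter is passed in unary, which
   costs only a factor depending on k. *)
Definition fpt_reducible (P Q : pproblem) : Prop :=
  exists (p : prog) (f g : nat -> nat) (c : nat),
    [/\ computable f, computable g &
      forall x k, instance P x k ->
        exists (t : nat) (s : store) (x' : seq bool) (k' : nat),
          [/\ exec p (init x (unary k)) t s,
              s 0 = x' /\ s 1 = unary k',
              t <= f k * (size x).+1 ^ c /\ k' <= g k,
              instance Q x' k' &
              positive P x k <-> positive Q x' k']].

(** * Encodings *)

Definition enc_nat (n : nat) : seq bool := rcons (unary n) false.

Definition enc_pair (A B : Type) (ea : A -> seq bool) (eb : B -> seq bool)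
    (x : A * B) : seq bool := ea x.1 ++ eb x.2.

Definition enc_seq (A : Type) (ea : A -> seq bool) (s : seq A) : seq bool :=
  enc_nat (size s) ++ flatten (map ea s).

Definition prefix_free (A : Type) (e : A -> seq bool) : Prop :=
  forall x y u v, e x ++ u = e y ++ v -> x = y /\ u = v.

Lemma prefix_free_inj (A : Type) (e : A -> seq bool) :
  prefix_free e -> injective e.
Proof. by move=> pe x y exy; have [] := pe x y [::] [::] (congr1 (cat^~ _) exy). Qed.

Lemma enc_nat_pf : prefix_free enc_nat.
Proof.
rewrite /enc_nat /unary; elim=> [|n IHn] [|m] u v //=; first by case.
by case=> /IHn [-> ->].
Qed.

Lemma enc_pair_pf (A B : Type) (ea : A -> seq bool) (eb : B -> seq bool) :
  prefix_free ea -> prefix_free eb -> prefix_free (enc_pair ea eb).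
Proof.
move=> pa pb [a b] [a' b'] u v; rewrite /enc_pair /= -!catA.
by case/pa=> -> /pb [-> ->].
Qed.

Lemma enc_seq_pf (A : Type) (ea : A -> seq bool) :
  prefix_free ea -> prefix_free (enc_seq ea).
Proof.
move=> pa s s' u v; rewrite /enc_seq -!catA => /enc_nat_pf [].
elim: s s' => [|x s IHs] [|y s'] //= [eqs]; rewrite -!catA => /pa [->].
by case/(IHs _ eqs)=> -> ->.
Qed.

(** * Weighted circuit satisfiability and W[1] *)

Variant gate_kind := NOT | AND | OR.

Record gate := Gate { kind : gate_kind; preds : seq nat }.

(* A circuit is a topologically sorted acyclic graph: nodes 0, ..., n - 1 are
   the n inputs, and the j-th gate is node n + j. *)
Record circuit := Circuit {
  inputs : nat;
  gates : seq gate;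
  output : nat
}.

Definition wf_gate (bound : nat) (g : gate) : bool :=
  [&& uniq (preds g), all (fun i => i < bound) (preds g) &
      match kind g with
      | NOT => size (preds g) == 1
      | _ => 1 < size (preds g)
      end].

Definition wf_circuit (C : circuit) : Prop :=
  (output C < inputs C + size (gates C)) /\
  (forall j, j < size (gates C) ->
     wf_gate (inputs C + j) (nth (Gate NOT [::]) (gates C) j)).

(* Values at all nodes, given those at the inputs and the value at a gate as a
   function of the values at its predecessors. *)
Definition node_values (A : Type) (a0 : A) (step : gate -> seq A -> A)
    (ins : seq A) (gs : seq gate) : seq A :=
  foldl (fun vs g => rcons vs (step g [seq nth a0 vs i | i <- preds g])) ins gs.

Definition output_value (A : Type) (a0 : A) (step : gate -> seq A -> A)
    (C : circuit) (ins : seq A) : A :=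
  nth a0 (node_values a0 step ins (gates C)) (output C).

Definition eval_gate (g : gate) (vs : seq bool) : bool :=
  match kind g with
  | NOT => ~~ head false vs
  | AND => all id vs
  | OR => has id vs
  end.

Definition eval (C : circuit) (a : seq bool) : bool :=
  output_value false eval_gate C a.

(* Maximum length of a path from an input to the output. *)
Definition depth (C : circuit) : nat :=
  output_value 0 (fun _ ds => (\max_(d <- ds) d).+1) C (nseq (inputs C) 0).

(* Maximum number of gates of in-degree more than 2 on such a path. *)
Definition weft (C : circuit) : nat :=
  output_value 0 (fun g ws => (2 < size (preds g)) + \max_(w <- ws) w)
    C (nseq (inputs C) 0).

Definition enc_gate (g : gate) : seq bool :=
  enc_pair enc_nat (enc_seq enc_nat)
    (match kind g with NOT => 0 | AND => 1 | OR => 2 end, preds g).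

Definition enc_circuit (C : circuit) : seq bool :=
  enc_pair (enc_pair enc_nat (enc_seq enc_gate)) enc_nat
    (inputs C, gates C, output C).

Lemma enc_circuit_inj : injective enc_circuit.
Proof.
have pg : prefix_free enc_gate.
  move=> [kg sg] [kh sh] u v /(enc_pair_pf enc_nat_pf (enc_seq_pf enc_nat_pf)).
  by case=> [[+ ->] ->] /=; case: kg; case: kh.
have pc := enc_pair_pf (enc_pair_pf enc_nat_pf (enc_seq_pf pg)) enc_nat_pf.
by move=> [n gs o] [n' gs' o'] /(prefix_free_inj pc) [-> -> ->].
Qed.

(* Weighted satisfiability of circuits of weft at most [t] and depth at most
   [d], parameterized by the weight. *)
Definition weighted_circuit_sat (t d : nat) : pproblem :=
  encoded_problem enc_circuit
    (fun C _ => [/\ wf_circuit C, weft C <= t & depth C <= d])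
    (fun C k => exists a : seq bool,
       [/\ size a = inputs C, count id a = k & eval C a]).

Definition W (t : nat) (P : pproblem) : Prop :=
  exists2 d, 0 < d & fpt_reducible P (weighted_circuit_sat t d).

Definition W_hard (t : nat) (Q : pproblem) : Prop :=
  forall P, W t P -> fpt_reducible P Q.

(** * Bipartite graphs *)

Definition interval_bigraph (R : realType) (X Y : Type) (E : X -> Y -> bool) :
    Prop :=
  exists (I : X -> interval R) (J : Y -> interval R),
    forall x y, E x y <-> exists p : R, p \in I x /\ p \in J y.

(* [E'] arises from [E] by adding at most [k] edges at each vertex of [X]. *)
Definition adds_at_most (k : nat) (X Y : finType) (E E' : X -> Y -> bool) :
    Prop :=
  (forall x y, E x y -> E' x y) /\
  (forall x, #|[set y | E' x y && ~~ E x y]| <= k).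

(** * Constraint satisfaction *)

(* A scope and the list of allowed tuples. *)
Definition constraint : Type := seq nat * seq (seq nat).
Definition scope (c : constraint) := c.1.
Definition allowed (c : constraint) := c.2.

(* The variables are 0, ..., nvars - 1 and the values 0, ..., nvals - 1. *)
Record csp := CSP {
  nvars : nat;
  nvals : nat;
  constraints : seq constraint
}.

Definition ncons (I : csp) : nat := size (constraints I).
Definition constr (I : csp) (i : nat) : constraint :=
  nth ([::], [::]) (constraints I) i.

Definition wf_constraint (n d : nat) (c : constraint) : bool :=
  [&& all (fun v => v < n) (scope c), uniq (allowed c) &
      all (fun a => (size a == size (scope c)) && all (fun b => b < d) a)
        (allowed c)].

(* The second clause says that the constraints form a set: no two of them have
   the same scope and the same relation. *)
Definition wf_csp (I : csp) : Prop :=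
  all (wf_constraint (nvars I) (nvals I)) (constraints I) /\
  (forall i j, i < ncons I -> j < ncons I ->
     scope (constr I i) = scope (constr I j) ->
     allowed (constr I i) =i allowed (constr I j) -> i = j).

Definition satisfiable (I : csp) : Prop :=
  exists a : nat -> nat,
    (forall v, v < nvars I -> a v < nvals I) /\
    (forall c, c \in constraints I -> map a (scope c) \in allowed c).

Definition incidence (I : csp) (i : 'I_(ncons I)) (v : 'I_(nvars I)) : bool :=
  (v : nat) \in scope (constr I i).

(* The graph given by the lists of the neighbours of 0, ..., m - 1. *)
Definition bigraph_of (m n : nat) (nb : seq (seq nat)) (i : 'I_m) (v : 'I_n) :
    bool :=
  (v : nat) \in nth [::] nb i.

Definition wf_bigraph (m n : nat) (nb : seq (seq nat)) : bool :=
  (size nb == m) && all (fun s => uniq s && all (fun v => v < n) s) nb.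

Definition enc_csp_bigraph (x : csp * seq (seq nat)) : seq bool :=
  let enc_constraint :=
    enc_pair (enc_seq enc_nat) (enc_seq (enc_seq enc_nat)) in
  enc_pair
    (enc_pair (enc_pair enc_nat enc_nat) (enc_seq enc_constraint))
    (enc_seq (enc_seq enc_nat))
    (nvars x.1, nvals x.1, constraints x.1, x.2).

Lemma enc_csp_bigraph_inj : injective enc_csp_bigraph.
Proof.
have ps := enc_seq_pf enc_nat_pf; have pss := enc_seq_pf ps.
have pI := enc_pair_pf (enc_pair_pf enc_nat_pf enc_nat_pf)
             (enc_seq_pf (enc_pair_pf ps pss)).
move=> [[n d cs] nb] [[n' d' cs'] nb'].
by move=> /(prefix_free_inj (enc_pair_pf pI pss)) [-> -> -> ->].
Qed.

(* Given a CSP instance with incidence graph G and an interval bigraph G'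
   obtained from G by adding at most k edges at each constraint, decide
   whether the instance is satisfiable; the parameter is k. *)
Definition csp_near_interval_bigraph (R : realType) : pproblem :=
  encoded_problem enc_csp_bigraph
    (fun x k =>
       let: (P, nb) := x in
       let G' := @bigraph_of (ncons P) (nvars P) nb in
       [/\ wf_csp P, wf_bigraph (ncons P) (nvars P) nb,
           interval_bigraph R G' & adds_at_most k (@incidence P) G'])
    (fun x _ => satisfiable x.1).

(* Main.v *)
Require Import Defs.
From mathcomp Require Import all_boot all_order all_algebra.
From mathcomp Require Import reals.
From mathcomp Require Import boolp zify.

(* Cut [0, n] at the k true inputs of an assignment into k + 1 segments, each
   made of false inputs followed by a true one (the last segment ends in a dummy
   input n).  Evaluate the circuit under partial information about the inputs
   with Kleene's three-valued logic, except that a gate of in-degree more than 2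
   whose value is not forced by a single predecessor takes the value it would
   have if nothing forced it: true for AND, false for OR.  In a circuit of weft 1
   and depth d some D = 2^d segments, revealed together with any further correct
   information, determine the output.  Hence the output is true iff there are D
   segments such that it evaluates to true after revealing any D more.  The
   first D are guessed by 2D additional CSP variables, and there is one
   constraint, of arity 4D + 2, for each choice of "D more" among the k + 1
   segments.  There are k + 2D + 2 variables in all, so every edge may be added,
   and a complete bipartite graph is an interval bigraph. *)

Set Implicit Arguments.
Unset Strict Implicit.
Unset Printing Implicit Defensive.

(** * Programs with a bound on the number of loop iterations *)

Arguments upd : simpl never.
Arguments enc_nat : simpl never.

Notation "p ;; q" := (Seq p q) (at level 62, right associativity).

(** The predecessors of a gate of large in-degree are too many to be revealed, hence the default
    value: it is right if no predecessor forces the gate, and otherwise one forcing predecessor is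
    enough. Segments are revealed rather than true inputs because a forcing predecessor may depend
    on false inputs; there are many of these, but each lies in one of only [k + 1] segments. A
    default may be wrong while the forcing segments are hidden. The guess and the universal choice
    take care of one direction each: for a satisfying assignment, guessing the determining segments
    makes all evaluations correct, whatever else is revealed; conversely, in a satisfied CSP some
    constraint reveals the determining segments and so evaluates correctly. A guess might still lie
    about an input, but the constraint revealing the segment of that input then meets a
    contradiction and rejects. As [d] is fixed, so is [D], and the [(k + 1) ^ D] constraints and the
    relation of [n ^ O(D)] tuples have polynomial size. *)

Lemma updE s r w i : upd s r w i = if i == r then w else s i.
Proof. by []. Qed.

Lemma upd_upd s r w w' : upd (upd s r w) r w' = upd s r w'.
Proof. by apply: funext => i; rewrite !updE; case: eqP. Qed.

Lemma upd_id s r : upd s r (s r) = s.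
Proof. by apply: funext => i; rewrite updE; case: eqP => [->|]. Qed.

Lemma updC s r r' w w' :
  r != r' -> upd (upd s r w) r' w' = upd (upd s r' w') r w.
Proof.
move=> ne; apply: funext => i; rewrite !updE.
by case: (eqVneq i r') => // ->; rewrite eq_sym (negbTE ne).
Qed.

Ltac neqs :=
  rewrite ?eqxx /=;
  repeat (match goal with
    | H : is_true (?a != ?b) |- context [?a == ?b] => rewrite (negbTE H)
    | H : is_true (?a != ?b) |- context [?b == ?a] =>
        rewrite [b == a]eq_sym (negbTE H)
    end);
  rewrite /=.

Ltac upd_eq :=
  let i := fresh "i" in
  apply: funext => i; rewrite !updE;
  repeat (match goal with |- context [if i == ?r then _ else _] =>
    case: (eqVneq i r) => [?|?]; [subst i|] end);
  neqs;
  try done.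

Notation rX := 0 (only parsing).    (* the encoded circuit; finally the output *)
Notation rK := 1 (only parsing).    (* the parameter *)
Notation rTMP := 2 (only parsing).
Notation rFL := 3 (only parsing).   (* loop flag of [read_nat] *)
Notation rNN := 4 (only parsing).   (* number of inputs plus one *)
Notation rLT := 5 (only parsing).   (* the pairs by which words are extended *)
Notation rT := 6 (only parsing).    (* list of words *)
Notation rT2 := 7 (only parsing).   (* list of extended words *)
Notation rW := 8 (only parsing).
Notation rW2 := 9 (only parsing).   (* current word *)
Notation rL2 := 10 (only parsing).
Notation rA := 11 (only parsing).
Notation rB := 12 (only parsing).
Notation rXC := 13 (only parsing).  (* unread part of the circuit *)
Notation rV := 14 (only parsing).
Notation rVV := 15 (only parsing).  (* cells of the nodes evaluated so far *)
Notation rI := 16 (only parsing).   (* index of the predecessor looked up *)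
Notation rM := 17 (only parsing).   (* predecessors left *)
Notation rS0 := 18 (only parsing).  (* predecessors known to be false *)
Notation rN1 := 19 (only parsing).  (* predecessors not known to be true *)
Notation rCM := 20 (only parsing).  (* predecessors read *)
Notation rR := 21 (only parsing).   (* the encoded relation *)
Notation rCR := 22 (only parsing).  (* its size *)
Notation rOUT := 23 (only parsing). (* the encoded constraints *)
Notation rNB := 24 (only parsing).  (* the encoded list of all variables *)
Notation rNBS := 25 (only parsing). (* the encoded supergraph *)
Notation rG := 26 (only parsing).   (* gates left *)
Notation rCN := 27 (only parsing).  (* number of constraints *)
Notation rNV := 28 (only parsing).  (* number of variables *)

Section Run.
Variable N : nat.

(** The worst case if no execution of a loop exceeds [N] rounds. Time bounds thus reduce to size
    bounds on the lists that loops run through. *)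
Fixpoint max_time (p : prog) : nat :=
  match p with
  | Skip | Push _ _ => 1
  | Seq p q => max_time p + max_time q
  | Case _ p q r => (max_time p + max_time q + max_time r).+1
  | While _ p => (N * (max_time p).+1).+1
  end.

Definition run (p : prog) (s s' : store) : Prop :=
  exists2 t, exec p s t s' & t <= max_time p.

(** Keeps the actual number of rounds apart from the cap [N], so that it can serve as induction
    variable. *)
Definition loop (r : nat) (p : prog) (m : nat) (s s' : store) : Prop :=
  exists2 t, exec (While r p) s t s' & t <= (m * (max_time p).+1).+1.

Lemma run_skip s : run Skip s s.
Proof. by exists 1 => //; constructor. Qed.

Lemma run_push r b s : run (Push r b) s (upd s r (b :: s r)).
Proof. by exists 1 => //; constructor. Qed.

Lemma run_seq p q s1 s2 s3 : run p s1 s2 -> run q s2 s3 -> run (p ;; q) s1 s3.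
Proof.
move=> [t e le] [u e' le']; exists (t + u); first by econstructor; eauto.
exact: leq_add.
Qed.

Lemma run_eq p s s1 s2 : run p s s1 -> s1 = s2 -> run p s s2.
Proof. by move=> ? <-. Qed.

Lemma run_caseN r p q q' s s' :
  s r = [::] -> run p s s' -> run (Case r p q q') s s'.
Proof.
move=> e [t h le]; exists t.+1; first exact: ExecCaseNil.
by rewrite /= ltnS; lia.
Qed.

Lemma run_caseC r p q q' s b w s' :
  s r = b :: w -> run (if b then q else q') (upd s r w) s' ->
  run (Case r p q q') s s'.
Proof.
move=> e [t h le]; exists t.+1.
  by case: b e h le => e h le; [apply: ExecCaseTrue | apply: ExecCaseFalse]; eauto.
by case: b e h le => e h le /=; rewrite ltnS; lia.
Qed.

Lemma loop0 r p s s' : s r = [::] -> s = s' -> loop r p 0 s s'.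
Proof. by move=> e <-; exists 1 => //; constructor. Qed.

Lemma loopS r p m s1 s2 s3 :
  s1 r <> [::] -> run p s1 s2 -> loop r p m s2 s3 -> loop r p m.+1 s1 s3.
Proof.
move=> ne [t h le] [u h' le']; exists (t + u).+1.
  by econstructor; eauto.
by lia.
Qed.

Lemma run_loop r p m s s' : loop r p m s s' -> m <= N -> run (While r p) s s'.
Proof.
move=> [t h le] lm; exists t => //; apply: (leq_trans le).
by rewrite /= ltnS leq_mul2r lm orbT.
Qed.

Lemma run_while_nat r p (g : nat -> store) m :
  m <= N -> g 0 r = [::] ->
  (forall j, j < m -> g j.+1 r <> [::] /\ run p (g j.+1) (g j)) ->
  run (While r p) (g m) (g 0).
Proof.
move=> le g0 step; apply: run_loop le; elim: m step => [|m IH] step.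
  exact: loop0.
by have [ne h] := step m (ltnSn _); apply: loopS h _ => //; apply: IH => j lj;
  apply: step; apply: ltnW.
Qed.

(** [g] is the loop invariant: its arguments are the elements already processed and those left. *)
Lemma run_while_seq (A : Type) r p (g : seq A -> seq A -> store) xs :
  size xs <= N -> g xs [::] r = [::] ->
  (forall u x v, xs = u ++ x :: v ->
     g u (x :: v) r <> [::] /\ run p (g u (x :: v)) (g (rcons u x) v)) ->
  run (While r p) (g [::] xs) (g xs [::]).
Proof.
move=> le g0 step; apply: run_loop le.
suff: forall v u, xs = u ++ v -> loop r p (size v) (g u v) (g xs [::]).
  by move=> /(_ xs [::]); apply.
elim=> [|x v IH] u exs; first by rewrite cats0 in exs; subst u; apply: loop0.
by have [ne h] := step _ _ _ exs; apply: loopS h _ => //; apply: IH; rewrite cat_rcons.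
Qed.

(** * Basic stack operations *)

Definition pop r := Case r Skip Skip Skip.

Lemma run_pop r s : run (pop r) s (upd s r (behead (s r))).
Proof.
case e: (s r) => [|b w].
  by apply: run_caseN => //=; rewrite -e upd_id; apply: run_skip.
by apply: run_caseC e _; case: b; apply: run_skip.
Qed.

Definition clear r := While r (pop r).

Lemma run_clear r s : size (s r) <= N -> run (clear r) s (upd s r [::]).
Proof.
move=> le; pose g (u v : seq bool) := upd s r v.
rewrite -{1}(upd_id s r); apply: (@run_while_seq _ _ _ g) => //.
  by rewrite /g updE eqxx.
move=> u x v _; rewrite /g updE eqxx; split=> //.
by apply: run_eq (run_pop _ _) _; rewrite /g !updE eqxx upd_upd.
Qed.

Definition transfer a b := While a (Case a Skip (Push b true) (Push b false)).

Lemma run_transfer a b s : a != b -> size (s a) <= N ->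
  run (transfer a b) s (upd (upd s b (rev (s a) ++ s b)) a [::]).
Proof.
move=> ne le; pose g (u v : seq bool) := upd (upd s b (rev u ++ s b)) a v.
have -> : s = g [::] (s a) by rewrite /g /= !upd_id.
have -> : upd (upd (g [::] (s a)) b (rev (g [::] (s a) a) ++ g [::] (s a) b)) a [::]
  = g (s a) [::].
  by rewrite /g !updE eqxx eq_sym (negbTE ne) eqxx; upd_eq.
apply: run_while_seq => //; first by rewrite /g updE eqxx.
move=> u x v _; rewrite /g updE eqxx; split=> //.
apply: run_caseC; first by rewrite updE eqxx.
rewrite upd_upd; apply: run_eq.
  by instantiate (1 := upd (upd (upd s b (rev u ++ s b)) a v) b
     (x :: upd (upd s b (rev u ++ s b)) a v b)); case: x; apply: run_push.
rewrite /g !updE eqxx [b == a]eq_sym (negbTE ne) rev_rcons /=.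
by upd_eq.
Qed.

(** A transfer reverses its stack; the way back from [rTMP] restores the order as well as [a]. *)
Definition copy a b :=
  transfer a rTMP ;;
  While rTMP (Case rTMP Skip (Push a true ;; Push b true)
                             (Push a false ;; Push b false)).

Lemma run_copy a b s :
  a != b -> a != rTMP -> b != rTMP -> s rTMP = [::] -> size (s a) <= N ->
  run (copy a b) s (upd s b (s a ++ s b)).
Proof.
move=> ne na nb e le; apply: run_seq (run_transfer _ le) _ => //.
pose g (u v : seq bool) := upd (upd (upd s a (rev u)) b (rev u ++ s b)) rTMP v.
have -> : upd (upd s rTMP (rev (s a) ++ s rTMP)) a [::] = g [::] (rev (s a)).
  by rewrite /g e cats0; upd_eq.
have -> : upd s b (s a ++ s b) = g (rev (s a)) [::].
  by rewrite /g revK upd_id -e; upd_eq.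
apply: run_while_seq => //; first by rewrite size_rev.
move=> u x v _; split=> //; apply: run_caseC; first by rewrite /g updE.
have h y : run (Push a y ;; Push b y) (upd (g u (y :: v)) rTMP v) (g (rcons u y) v).
  apply: run_seq (run_push _ _ _) _; apply: run_eq (run_push _ _ _) _.
  rewrite /g rev_rcons !updE !eqxx /=.
  by upd_eq.
by case: x.
Qed.

(** [While] tests only emptiness, whereas a number ends at the symbol [false]; popping the flag
    [rFL] turns one condition into the other. The number arrives reversed, its terminator on top. *)
Definition read_nat r a :=
  Push rFL true ;;
  While rFL (Case r (pop rFL) (Push a true) (pop rFL ;; Push a false)).

Lemma run_read_nat r a s v u :
  r != a -> r != rFL -> a != rFL -> s rFL = [::] -> v < N ->
  s r = enc_nat v ++ u ->
  run (read_nat r a) s (upd (upd s r u) a (rev (enc_nat v) ++ s a)).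
Proof.
move=> ne nr na e le er; apply: run_seq (run_push _ _ _) _; rewrite e.
pose g (j : nat) := upd (upd (upd s r (enc_nat j ++ u)) a (nseq (v - j) true ++ s a))
   rFL [:: true].
apply: run_loop (_ : v < N) => //.
have -> : upd s rFL [:: true] = g v.
  by rewrite /g subnn -er !upd_id.
set fin := upd _ a _.
have : v <= v by [].
move: {-2}v => j; elim: j => [|j IH] lj.
  apply: loopS; first by rewrite /g updE.
    apply: run_caseC; first by rewrite /g !updE (negbTE nr) (negbTE ne) eqxx.
    by apply: run_seq; [apply: run_pop | apply: run_push].
  rewrite /fin /g subn0 rev_rcons rev_nseq.
  by apply: loop0; [rewrite !updE; neqs | upd_eq].
apply: loopS (IH (ltnW lj)); first by rewrite /g updE.
apply: run_caseC; first by rewrite /g !updE (negbTE nr) (negbTE ne) eqxx.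
apply: run_eq (run_push _ _ _) _; rewrite /g -[v - j]prednK ?subn_gt0 // -subnS.
by upd_eq.
Qed.

Definition read_unary r a := read_nat r a ;; pop a.

Lemma run_read_unary r a s v u :
  r != a -> r != rFL -> a != rFL -> s rFL = [::] -> v < N ->
  s r = enc_nat v ++ u ->
  run (read_unary r a) s (upd (upd s r u) a (unary v ++ s a)).
Proof.
move=> ne nr na e le er; apply: run_seq (run_read_nat ne nr na e le er) _.
apply: run_eq (run_pop _ _) _; rewrite rev_rcons rev_nseq updE eqxx /=.
by rewrite upd_upd.
Qed.

Fixpoint push_ones r n := if n is m.+1 then Push r true ;; push_ones r m else Skip.

Lemma run_push_ones r n s : run (push_ones r n) s (upd s r (unary n ++ s r)).
Proof.
elim: n s => [|n IH] s /=; first by rewrite upd_id; apply: run_skip.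
apply: run_seq (run_push _ _ _) _; apply: run_eq (IH _) _.
by rewrite updE eqxx upd_upd; congr upd; elim: n {IH} => //= n ->.
Qed.

End Run.

(** * Three-valued evaluation of a circuit by a program *)

(* What is known about a node: whether it is known to be true, and whether it is
   known to be false. *)
Definition cell := (bool * bool)%type.
Definition swap_if (b : bool) (c : cell) : cell := if b then (c.2, c.1) else c.
Definition flat_cells (cs : seq cell) : seq bool :=
  flatten [seq [:: c.1; c.2] | c <- cs].

Lemma rev_flat_cells_rcons cs c : rev (flat_cells (rcons cs c)) = c.2 :: c.1 :: rev
  (flat_cells cs).
Proof. by rewrite /flat_cells map_rcons flatten_rcons rev_cat. Qed.

(** [a] and [b] are the end points of a segment relative to the cell, truncated at 0: the cell is in
    the segment if [a] is 0 and [b] positive, and is its final, true, input if [b] is 1. Facts are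
    added, never overwritten, so that contradictions stay visible as [(true, true)]. *)
Definition paint1 (a b : nat) (c : cell) : cell :=
  if a is 0 then match b with 0 => c | 1 => (true, c.2) | _ => (c.1, true) end
  else c.

Fixpoint paint (a b : nat) (cs : seq cell) : seq cell :=
  if cs is c :: cs' then paint1 a b c :: paint a.-1 b.-1 cs' else [::].

Lemma size_paint a b cs : size (paint a b cs) = size cs.
Proof. by elim: cs a b => //= c cs IH a b; rewrite IH. Qed.

Lemma nth_paint a b cs q c0 : q < size cs ->
  nth c0 (paint a b cs) q = paint1 (a - q) (b - q) (nth c0 cs q).
Proof.
elim: cs a b q => //= c cs IH a b [|q] lq; first by rewrite !subn0.
by rewrite /= IH // -!subn1 -!subnDA add1n.
Qed.

Lemma paint_rcons a b cs c :
  paint a b (rcons cs c) =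
  rcons (paint a b cs) (paint1 (a - size cs) (b - size cs) c).
Proof.
elim: cs a b => [|c' cs IH] a b /=; first by rewrite !subn0.
by rewrite IH -!subn1 -!subnDA add1n.
Qed.

(* With more than two inputs the conjunction is taken to be true as long as no
   input is known to be false. *)
Definition conj_cells (cs : seq cell) : cell :=
  let s0 := has snd cs in (if 2 < size cs then ~~ s0 else all fst cs, s0).

(** All gates become conjunctions: OR by De Morgan's law, NOT as the negated conjunction of its
    single input. *)
Definition negates_inputs (k : gate_kind) : bool := if k is OR then true else false.
Definition negates_output (k : gate_kind) : bool := if k is AND then false else true.

Definition cell_step (g : gate) (cs : seq cell) : cell :=
  swap_if (negates_output (kind g)) (conj_cells [seq swap_if (negates_inputs (kind
    g)) c | c <- cs]).

Definition unknown : cell := (false, false).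

Section Check.
Variable N : nat.
Notation run := (run N).

Definition read_cell (f : bool -> bool -> prog) : prog :=
  Case rV Skip
    (Case rV Skip (f true true) (f true false))
    (Case rV Skip (f false true) (f false false)).

Definition write_cell (c1 c0 : bool) : prog := Push rVV c1 ;; Push rVV c0.

Lemma run_read_cell f s c u s' :
  s rV = c.1 :: c.2 :: u -> run (f c.1 c.2) (upd s rV u) s' -> run (read_cell f) s s'.
Proof.
case: c => c1 c0 /= e h; apply: run_caseC e _.
have h' : run (if c0 then f c1 true else f c1 false)
   (upd (upd s rV (c0 :: u)) rV u) s' by rewrite upd_upd; case: c0 h.
by case: c1 {h} h' => h'; apply: run_caseC h'; rewrite updE.
Qed.

Lemma run_write_cell c1 c0 s :
  run (write_cell c1 c0) s (upd s rVV (c0 :: c1 :: s rVV)).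
Proof.
apply: run_seq (run_push _ _ _ _) _; apply: run_eq (run_push _ _ _ _) _.
by rewrite updE /= upd_upd.
Qed.

(* [rVV] holds the cells in reverse, so that the cell of a new node can be pushed;
   a pass visits them from node 0 on and rebuilds [rVV]. *)
Definition pass f := transfer rVV rV ;; While rV (read_cell f).

Lemma size_flat_cells cs : size (flat_cells cs) = (size cs).*2.
Proof. by elim: cs => //= c cs ->. Qed.

(** [h u] is the store, apart from [rV], after the cells [u] have been visited. *)
Lemma run_pass f s cs (h : seq cell -> store) :
  s rVV = rev (flat_cells cs) -> s rV = [::] -> (size cs).*2 <= N ->
  h [::] = upd s rVV [::] ->
  (forall u x v, cs = u ++ x :: v ->
     run (f x.1 x.2) (upd (h u) rV (flat_cells v)) (upd (h (rcons u x)) rV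
       (flat_cells v))) ->
  run (pass f) s (upd (h cs) rV [::]).
Proof.
move=> eVV eV le h0 step; apply: run_seq.
  by apply: run_transfer; rewrite // eVV size_rev size_flat_cells.
pose g (u v : seq cell) := upd (h u) rV (flat_cells v).
have -> : upd (upd s rV (rev (s rVV) ++ s rV)) rVV [::] = g [::] cs.
  by rewrite eVV eV revK cats0 /g h0 updC.
apply: (@run_while_seq _ _ _ _ g) => //; first by lia.
move=> u x v e; rewrite /g updE; split=> //.
by apply: run_read_cell; [rewrite updE | rewrite upd_upd; apply: step].
Qed.

(** Both counters must lose one mark per cell, as in [paint]. Distinguishing 1 from larger values of
    [rB] pops two marks, so one is put back. *)
Definition paint_cell (c1 c0 : bool) : prog :=
  Case rA (Case rB (write_cell c1 c0)
             (Case rB (write_cell true c0) (Push rB true ;;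
               write_cell c1 true) Skip) Skip)
    (pop rB ;; write_cell c1 c0) Skip.

Definition paint_prog : prog := pass paint_cell ;; clear rA ;; clear rB.

Lemma run_paint s cs a b :
  s rVV = rev (flat_cells cs) -> s rV = [::] -> (size cs).*2 <= N ->
  s rA = unary a -> s rB = unary b -> a <= N -> b <= N ->
  run paint_prog s (upd (upd (upd s rVV (rev (flat_cells (paint a b cs)))) rA [::])
    rB [::]).
Proof.
move=> eVV eV le eA eB la lb.
pose h u := upd (upd (upd s rVV (rev (flat_cells (paint a b u)))) rA (unary (a - size
  u)))
  rB (unary (b - size u)).
apply: run_seq.
  apply: (@run_pass _ _ cs h) => //.
    by rewrite /h /= ?subn0; upd_eq.
  move=> u x v _; rewrite /h paint_rcons rev_flat_cells_rcons size_rcons !subnS.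
  case: (a - size u) => [|a'].
    apply: run_caseN; first by rewrite !updE.
    case: (b - size u) => [|b'].
      apply: run_caseN; first by rewrite !updE.
      by apply: run_eq (run_write_cell _ _ _) _; upd_eq.
    apply: run_caseC; first by rewrite !updE.
    case: b' => [|b'] /=.
      apply: run_caseN; first by rewrite !updE.
      by apply: run_eq (run_write_cell _ _ _) _; upd_eq.
    apply: run_caseC; first by rewrite !updE.
    apply: run_seq (run_push _ _ _ _) _.
    by apply: run_eq (run_write_cell _ _ _) _; upd_eq.
  apply: run_caseC; first by rewrite !updE.
  apply: run_seq (run_pop _ _ _) _.
  apply: run_eq (run_write_cell _ _ _) _; upd_eq.
  by case: (b - size u).
apply: run_seq (run_clear _) _.
  by rewrite /h !updE /= size_nseq; lia.
apply: run_eq (run_clear _) _.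
  by rewrite /h !updE /= size_nseq; lia.
by rewrite /h; upd_eq.
Qed.

Definition acc (c : cell) : prog :=
  (if c.1 then Skip else Push rN1 true) ;; (if c.2 then Push rS0 true else Skip).

Lemma run_acc c s :
  run (acc c) s (upd (upd s rN1 (unary (~~ c.1) ++ s rN1)) rS0 (unary c.2 ++ s rS0)).
Proof.
apply: (run_seq (s2 := upd s rN1 (unary (~~ c.1) ++ s rN1))).
  by case: (c.1); [rewrite /unary /= upd_id; apply: run_skip | apply: run_push].
have -> : s rS0 = upd s rN1 (unary (~~ c.1) ++ s rN1) rS0 by [].
by case: (c.2); [apply: run_push | rewrite /unary /= upd_id; apply: run_skip].
Qed.

(* The cell is reached when a single mark is left on [rI]; popping that mark keeps
   the later cells from being taken for it. *)
Definition lookup_cell (sw c1 c0 : bool) : prog :=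
  write_cell c1 c0 ;;
  Case rI Skip (Case rI (acc (swap_if sw (c1, c0))) (Push rI true) Skip) Skip.

Definition lookup sw : prog := pass (lookup_cell sw).

Lemma run_lookup sw s cs i :
  s rVV = rev (flat_cells cs) -> s rV = [::] -> (size cs).*2 <= N ->
  s rI = unary i.+1 -> i < size cs ->
  let c := swap_if sw (nth unknown cs i) in
  run (lookup sw) s (upd (upd (upd s rI [::]) rN1 (unary (~~ c.1) ++ s rN1))
                      rS0 (unary c.2 ++ s rS0)).
Proof.
move=> eVV eV le eI li c.
pose h u := upd (upd (upd (upd s rI (unary (i.+1 - size u))) rVV (rev (flat_cells u)))
   rN1 (if size u <= i then s rN1 else unary (~~ c.1) ++ s rN1))
   rS0 (if size u <= i then s rS0 else unary c.2 ++ s rS0).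
apply: run_eq.
  apply: (@run_pass _ _ cs h) => //.
    by rewrite /h /= ?subn0; upd_eq.
  move=> u x v ecs; apply: run_seq (run_write_cell _ _ _) _.
  rewrite /h rev_flat_cells_rcons size_rcons subSS.
  case: (ltngtP (size u) i) => [lt|gt|eq].
  - rewrite subSn; last exact: ltnW.
    apply: run_caseC; first by rewrite !updE.
    rewrite -[i - size u]prednK ?subn_gt0 //.
    apply: run_caseC; first by rewrite !updE.
    by apply: run_eq (run_push _ _ _ _) _; upd_eq.
  - rewrite -subn_eq0 in gt; rewrite (eqP gt).
    have -> : i - size u = 0 by apply/eqP; rewrite subn_eq0 ltnW // -subn_eq0.
    apply: run_caseN; first by rewrite !updE.
    by apply: run_eq (run_skip _ _) _; upd_eq.
  - rewrite eq subSnn subnn.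
    apply: run_caseC; first by rewrite !updE.
    apply: run_caseN; first by rewrite !updE.
    apply: run_eq (run_acc _ _) _.
    have -> : swap_if sw (x.1, x.2) = c.
      by rewrite /c -eq ecs nth_cat ltnn subnn /=; case: (x).
    by upd_eq.
rewrite /h leqNgt li /=.
have -> : i.+1 - size cs = 0 by apply/eqP; rewrite subn_eq0.
by upd_eq.
Qed.

Definition pred_step sw : prog :=
  read_unary rXC rI ;; Push rI true ;; lookup sw ;; Push rCM true.

Definition write_swapped (so : bool) (c1 c0 : bool) : prog :=
  write_cell (swap_if so (c1, c0)).1 (swap_if so (c1, c0)).2.

Definition finish_small so : prog :=
  Case rN1 (Case rS0 (write_swapped so true false) (write_swapped so true true) Skip)
    (Case rS0 (write_swapped so false false) (write_swapped so false true) Skip) Skip.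

Definition finish_large so : prog :=
  Case rS0 (write_swapped so true false) (write_swapped so false true) Skip.

Lemma run_pred_step sw s cs i u :
  s rXC = enc_nat i ++ u -> s rVV = rev (flat_cells cs) -> s rV = [::] ->
  s rFL = [::] -> s rI = [::] ->
  (size cs).*2 <= N -> i < size cs ->
  let c := swap_if sw (nth unknown cs i) in
  run (pred_step sw) s
    (upd (upd (upd (upd s rXC u) rN1 (unary (~~ c.1) ++ s rN1))
       rS0 (unary c.2 ++ s rS0)) rCM (true :: s rCM)).
Proof.
move=> eX eVV eV eF eI le li c.
apply: run_seq; first by apply: run_read_unary eX => //; lia.
apply: run_seq (run_push _ _ _ _) _.
apply: run_seq.
  by apply: (@run_lookup _ _ cs i); rewrite ?updE //= eI cats0.
by apply: run_eq (run_push _ _ _ _) _; rewrite -/c; upd_eq; rewrite eI.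
Qed.

Lemma run_write_swapped so c1 c0 s :
  run (write_swapped so c1 c0) s
    (upd s rVV ((swap_if so (c1, c0)).2 :: (swap_if so (c1, c0)).1 :: s rVV)).
Proof. exact: run_write_cell. Qed.

Lemma run_finish_small so a b s : s rS0 = unary a -> s rN1 = unary b ->
  run (finish_small so) s
    (upd (upd (upd s rS0 (unary a.-1)) rN1 (unary b.-1))
      rVV ((swap_if so (b == 0, 0 < a)).2 :: (swap_if so (b == 0, 0 < a)).1 :: s rVV)).
Proof.
move=> ea eb; case: b eb => [|b] eb.
  apply: run_caseN => //; case: a ea => [|a] ea.
    apply: run_caseN => //; apply: run_eq (run_write_swapped _ _ _ _) _.
    by upd_eq.
  apply: run_caseC ea _; apply: run_eq (run_write_swapped _ _ _ _) _.
  by upd_eq.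
apply: run_caseC eb _; case: a ea => [|a] ea.
  apply: run_caseN => //; apply: run_eq (run_write_swapped _ _ _ _) _.
  by upd_eq.
apply: run_caseC; first by rewrite updE /= ea.
apply: run_eq (run_write_swapped _ _ _ _) _.
by upd_eq.
Qed.

Lemma run_finish_large so a s : s rS0 = unary a ->
  run (finish_large so) s
    (upd (upd s rS0 (unary a.-1))
      rVV ((swap_if so (a == 0, 0 < a)).2 :: (swap_if so (a == 0, 0 < a)).1 :: s rVV)).
Proof.
case: a => [|a] ea.
  apply: run_caseN => //; apply: run_eq (run_write_swapped _ _ _ _) _.
  by upd_eq.
apply: run_caseC ea _; apply: run_eq (run_write_swapped _ _ _ _) _.
by upd_eq.
Qed.

(** Large in-degree is recognized by popping three marks from [rCM]. *)
Definition finish so : prog :=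
  Case rCM (finish_small so)
    (Case rCM (finish_small so)
       (Case rCM (finish_small so) (finish_large so) Skip) Skip) Skip.

Lemma run_finish so cs s vs :
  s rS0 = unary (count snd cs) -> s rN1 = unary (count (predC fst) cs) ->
  s rCM = unary (size cs) -> s rVV = rev (flat_cells vs) -> size cs <= N ->
  run (finish so ;; clear rS0 ;; clear rN1 ;; clear rCM) s
  (upd (upd (upd (upd s rS0 [::]) rN1 [::]) rCM [::])
     rVV (rev (flat_cells (rcons vs (swap_if so (conj_cells cs)))))).
Proof.
move=> e0 e1 eC eVV le.
set c := swap_if so _.
have leC b : count b cs <= N by apply: leq_trans le; apply: count_size.
(* What remains on the three counters depends on the branch taken; only its size matters, since it
   is cleared next. *)
have [w0 [w1 [w2 [l0 l1 l2 h]]]] : exists w0 w1 w2,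
  [/\ w0 <= N, w1 <= N, w2 <= N &
   run (finish so) s (upd (upd (upd (upd s rS0 (unary w0)) rN1 (unary w1))
      rCM (unary w2)) rVV (c.2 :: c.1 :: s rVV))].
  have small : size cs <= 2 ->
     c = swap_if so (count (predC fst) cs == 0, 0 < count snd cs).
    rewrite /c /conj_cells leqNgt => /negbTE -> /=; congr (swap_if so (_, _)).
      by rewrite all_count -(count_predC fst cs) -{1}[count fst cs]addn0 eqn_add2l
        eq_sym.
    by rewrite has_count.
  exists (count snd cs).-1.
  have [ge|lt] := leqP (size cs) 2; last first.
    exists (count (predC fst) cs), (size cs - 3).
    split; [exact: leq_trans (leq_pred _) (leC _)|exact: leC|lia|].
    have -> : c = swap_if so (count snd cs == 0, 0 < count snd cs).
      rewrite /c /conj_cells lt has_count; congr (swap_if so (_, _)).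
      by rewrite -leqNgt leqn0.
    rewrite /finish; case: (size cs) lt eC => [|[|[|m]]] // _ eC.
    apply: run_caseC eC _; apply: run_caseC; first by rewrite updE.
    apply: run_caseC; first by rewrite updE.
    rewrite !upd_upd; apply: run_eq.
      by apply: run_finish_large; rewrite updE /=; apply: e0.
    by rewrite subSS subn2 /= ; upd_eq; rewrite e1.
  exists (count (predC fst) cs).-1, 0.
  split; [exact: leq_trans (leq_pred _) (leC _)|exact: leq_trans (leq_pred _) (leC
    _)|by []|].
  rewrite (small ge) /finish; case: (size cs) ge eC => [|[|[|m]]] // _ eC.
  - by apply: run_caseN => //; apply: run_eq (run_finish_small _ e0 e1) _; upd_eq.
  - apply: run_caseC eC _; apply: run_caseN; first by rewrite updE.
    apply: run_eq.
      by apply: run_finish_small; rewrite updE /=; [apply: e0 | apply: e1].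
    by upd_eq.
  - apply: run_caseC eC _; apply: run_caseC; first by rewrite updE.
    apply: run_caseN; first by rewrite updE.
    apply: run_eq.
      by apply: run_finish_small; rewrite !updE /=; [apply: e0 | apply: e1].
    by upd_eq.
apply: run_seq h _.
apply: run_seq (run_clear _) _; first by rewrite !updE /= size_nseq.
apply: run_seq (run_clear _) _; first by rewrite !updE /= size_nseq.
apply: run_eq (run_clear _) _; first by rewrite !updE /= size_nseq.
by rewrite eVV rev_flat_cells_rcons; upd_eq.
Qed.

Definition gate_body si so : prog :=
  read_unary rXC rM ;;
  While rM (pop rM ;; pred_step si) ;;
  finish so ;; clear rS0 ;; clear rN1 ;; clear rCM.

Lemma run_gate_body si so s vs ps u :
  s rXC = enc_seq enc_nat ps ++ u -> s rVV = rev (flat_cells vs) -> s rV = [::] ->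
  s rFL = [::] -> s rI = [::] -> s rS0 = [::] -> s rN1 = [::] ->
  s rCM = [::] -> s rM = [::] -> 
  (size vs).*2 <= N -> size ps < N -> all (fun i => i < size vs) ps ->
  run (gate_body si so) s
    (upd (upd s rXC u) rVV (rev (flat_cells (rcons vs
       (swap_if so (conj_cells [seq swap_if si (nth unknown vs i) | i <- ps])))))).
Proof.
move=> eX eVV eV eF eI e0 e1 eC eM le lp al.
apply: run_seq.
  by apply: (@run_read_unary _ _ _ _ (size ps) (flatten (map enc_nat ps) ++ u)) =>
    //; rewrite eX /enc_seq -catA.
rewrite eM cats0.
pose f i := swap_if si (nth unknown vs i).
pose cs u := [seq f i | i <- u].
pose g (u' v : seq nat) := upd (upd (upd (upd (upd s rXC (flatten (map enc_nat v) ++ u))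
  rM (unary (size v))) rN1 (unary (count (predC fst) (cs u'))))
  rS0 (unary (count snd (cs u')))) rCM (unary (size u')).
apply: run_seq.
  have -> : upd (upd s rXC (flatten [seq enc_nat i | i <- ps] ++ u)) rM
    (unary (size ps)) = g [::] ps by rewrite /g /=; upd_eq.
  apply: (@run_while_seq _ _ _ _ g); rewrite 1?ltnW //.
  move=> u' x v ep; rewrite /g updE; split=> //.
  apply: run_seq (run_pop _ _ _) _.
  apply: run_eq.
    apply: (@run_pred_step _ _ vs x); rewrite ?updE //=.
    - by rewrite -catA.
    - by move: al; rewrite ep all_cat /= => /and3P [].
  rewrite /cs map_rcons -!cats1 !count_cat /=.
  upd_eq => //.
  - by rewrite size_cat addn1.
  - by rewrite /f /unary -nseqD addnC addn0.
  - by rewrite /f /unary -nseqD addnC addn0.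
rewrite -/(finish so); apply: run_eq.
  apply: (@run_finish so (cs ps) _ vs); rewrite ?updE //=.
  - by rewrite size_map.
  - by rewrite size_map ltnW.
by rewrite /g /cs /f; upd_eq; rewrite ?e0 ?e1 ?eC.
Qed.

Definition gate_prog : prog :=
  Case rXC Skip
    (Case rXC Skip (Case rXC Skip Skip (gate_body true true))
       (gate_body false false))
    (gate_body false true).

Lemma run_gate s vs g u :
  s rXC = enc_gate g ++ u -> s rVV = rev (flat_cells vs) -> s rV = [::] ->
  s rFL = [::] -> s rI = [::] -> s rS0 = [::] -> s rN1 = [::] ->
  s rCM = [::] -> s rM = [::] -> 
  (size vs).*2 <= N -> size (preds g) < N ->
  all (fun i => i < size vs) (preds g) ->
  run gate_prog s
    (upd (upd s rXC u) rVV (rev (flat_cells (rcons vs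
       (cell_step g [seq nth unknown vs i | i <- preds g]))))).
Proof.
move=> eX eVV eV eF eI e0 e1 eC eM le lp al.
have -> : cell_step g [seq nth unknown vs i | i <- preds g] =
   swap_if (negates_output (kind g)) (conj_cells [seq swap_if (negates_inputs (kind
     g)) (nth unknown vs i) | i <- preds g]).
  by rewrite /cell_step -map_comp.
case: g eX al lp => [[] ps] /= eX al lp; rewrite /gate_prog.
- have {}eX : s rXC = [:: false & enc_seq enc_nat ps ++ u] by rewrite eX.
  apply: run_caseC eX _; apply: run_eq.
    by apply: (@run_gate_body _ _ _ vs ps); rewrite ?updE.
  by upd_eq.
- have {}eX : s rXC = [:: true, false & enc_seq enc_nat ps ++ u] by rewrite eX.
  apply: run_caseC eX _; apply: run_caseC; first by rewrite updE.
  rewrite upd_upd; apply: run_eq.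
    by apply: (@run_gate_body _ _ _ vs ps); rewrite ?updE.
  by upd_eq.
- have {}eX : s rXC = [:: true, true, false & enc_seq enc_nat ps ++ u] by rewrite eX.
  apply: run_caseC eX _; apply: run_caseC; first by rewrite updE.
  apply: run_caseC; first by rewrite updE.
  rewrite !upd_upd; apply: run_eq.
    by apply: (@run_gate_body _ _ _ vs ps); rewrite ?updE.
  by upd_eq.
Qed.

Lemma size_node_values (A : Type) (a0 : A) st ins gs :
  size (node_values a0 st ins gs) = size ins + size gs.
Proof.
rewrite /node_values; elim: gs ins => [|g gs IH] ins /=; first by rewrite addn0.
by rewrite IH size_rcons addSnnS.
Qed.

Lemma node_values_rcons (A : Type) (a0 : A) st ins gs g :
  node_values a0 st ins (rcons gs g) =
  rcons (node_values a0 st ins gs)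
    (st g [seq nth a0 (node_values a0 st ins gs) i | i <- preds g]).
Proof. by rewrite /node_values -cats1 foldl_cat. Qed.

Definition bad_cell (c1 c0 : bool) : prog :=
  if c1 && c0 then Push rN1 true else Skip.

Definition eval_prog : prog :=
  read_unary rXC rG ;;
  While rG (pop rG ;; gate_prog) ;;
  read_unary rXC rI ;; Push rI true ;; lookup false ;; clear rS0 ;; pass bad_cell.

(** It vanishes iff the revealed facts cause no contradiction and the output is evaluated to true.
    It is a number because the program accumulates it as the height of [rN1]. *)
Definition badness (vs : seq cell) (out : nat) : nat :=
  count (fun c => c.1 && c.2) vs + ~~ (nth unknown vs out).1.

Lemma run_eval s ins gs out :
  s rXC = enc_seq enc_gate gs ++ enc_nat out -> s rVV = rev (flat_cells ins) ->
  s rV = [::] -> s rFL = [::] -> s rI = [::] -> s rS0 = [::] -> s rN1 = [::] ->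
  s rCM = [::] -> s rM = [::] -> s rG = [::] ->
  (size ins + size gs).*2 <= N -> out < size ins + size gs ->
  (forall u g v, gs = u ++ g :: v -> size (preds g) < N /\
     all (fun i => i < size ins + size u) (preds g)) ->
  run eval_prog s
    (upd (upd (upd s rXC [::]) rVV [::])
       rN1 (unary (badness (node_values unknown cell_step ins gs) out))).
Proof.
move=> eX eVV eV eF eI e0 e1 eC eM eG le lo wf.
apply: run_seq.
  apply: (@run_read_unary _ _ _ _ (size gs) (flatten (map enc_gate gs) ++ enc_nat
    out))=> //; first by lia.
  by rewrite eX /enc_seq -catA.
rewrite eG cats0.
pose nv u := node_values unknown cell_step ins u.
pose g (u v : seq gate) := upd (upd (upd s rXC (flatten (map enc_gate v) ++ enc_nat
  out))
  rG (unary (size v))) rVV (rev (flat_cells (nv u))).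
apply: run_seq.
  have -> : upd (upd s rXC (flatten [seq enc_gate i | i <- gs] ++ enc_nat out)) rG
    (unary (size gs)) = g [::] gs by rewrite /g /=; upd_eq.
  apply: (@run_while_seq _ _ _ _ g); first by lia.
    by rewrite /g updE.
  move=> u x v ep; rewrite /g updE; split=> //.
  have [lp al] := wf _ _ _ ep.
  apply: run_seq (run_pop _ _ _) _.
  have lu : size u <= size gs by rewrite ep size_cat leq_addr.
  apply: run_eq.
    apply: (@run_gate _ (nv u) x); rewrite ?updE //=.
    - by rewrite -catA.
    - by rewrite size_node_values; lia.
    - by rewrite size_node_values.
  by rewrite /nv node_values_rcons; upd_eq.
set vs := node_values _ _ _ _.
have sv : size vs = size ins + size gs by rewrite size_node_values.
apply: run_seq.
  apply: (@run_read_unary _ _ _ _ out [::]) => //; first by lia.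
  by rewrite /g !updE /= cats0.
apply: run_seq (run_push _ _ _ _) _.
apply: run_seq.
  apply: (@run_lookup _ _ vs out); rewrite /g ?updE //= ?sv //.
  by rewrite eI cats0.
apply: run_seq.
  apply: run_clear; rewrite /g !updE /= e0 cats0 size_nseq.
  by case: (_.2) => /=; lia.
pose b := fun c : cell => c.1 && c.2.
pose h u := upd (upd (upd s rXC [::]) rVV [::])
    rN1 (unary (count b u + ~~ (nth unknown vs out).1)).
apply: run_eq.
  apply: (@run_pass _ _ vs h); rewrite /g ?updE ?sv //=.
    by rewrite /h /=; upd_eq; rewrite ?e1 ?eI ?e0 ?eG ?cats0.
  move=> u x v ecs; rewrite /h -cats1 count_cat /= addn0 /bad_cell -/(b x).
  case: (b x) => /=; last by rewrite addn0; apply: run_skip.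
  apply: run_eq (run_push _ _ _ _) _; rewrite addn1 /=.
  by upd_eq.
by rewrite /h /badness; upd_eq.
Qed.

Definition enc_word (ps : seq (nat * nat)) : seq bool :=
  flatten [seq enc_pair enc_nat enc_nat p | p <- ps].

Definition paints (ps : seq (nat * nat)) (cs : seq cell) : seq cell :=
  foldl (fun cs p => paint p.1 p.2 cs) cs ps.

Lemma size_paints ps cs : size (paints ps cs) = size cs.
Proof. by elim: ps cs => //= p ps IH cs; rewrite IH size_paint. Qed.

Definition circuit_cells (C : circuit) (ps : seq (nat * nat)) : seq cell :=
  node_values unknown cell_step (paints ps (nseq (inputs C) unknown)) (gates C).

Definition word_badness (C : circuit) (ps : seq (nat * nat)) : nat :=
  badness (circuit_cells C ps) (output C).

Definition check_prog : prog :=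
  copy rX rXC ;; read_unary rXC rA ;; While rA (pop rA ;; write_cell false false) ;;
  copy rW2 rW ;; While rW (read_unary rW rA ;; read_unary rW rB ;; paint_prog) ;;
    eval_prog.

Definition scratch := [:: rTMP; rFL; rW; rA; rB; rXC; rV; rVV; rI; rM; rS0; rN1; rCM;
  rG].

(** All scratch stacks except [rN1] end up empty again, so that the check can be repeated word after
    word. *)
Lemma run_check s C ps :
  (forall r, r \in scratch -> s r = [::]) ->
  s rX = enc_circuit C -> s rW2 = enc_word ps ->
  wf_circuit C -> (inputs C + size (gates C)).*2 <= N ->
  all (fun g => size (preds g) < N) (gates C) ->
  size (enc_circuit C) <= N -> size (enc_word ps) <= N ->
  all (fun p => (p.1 < N) && (p.2 < N)) ps -> size ps <= N ->
  run check_prog s (upd s rN1 (unary (word_badness C ps))).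
Proof.
move=> cl eX eW [wo wg] le lg lX lW lp lps.
have CL := (cl rTMP isT, cl rFL isT, cl rW isT, cl rA isT, cl rB isT, cl rXC isT, cl
  rV isT, cl rVV isT, cl rI isT, cl rM isT, cl rS0 isT, cl rN1 isT, cl rCM isT, cl rG
    isT).
apply: run_seq (run_copy _ _ _ _ _) _; rewrite ?CL ?eX //.
rewrite cats0.
set rest := enc_seq enc_gate (gates C) ++ enc_nat (output C).
apply: run_seq.
  apply: (@run_read_unary _ _ _ _ (inputs C) rest); rewrite ?updE ?CL //; last first.
    by rewrite /enc_circuit /enc_pair /= -catA.
  by move: le wo; rewrite -addnn; lia.
rewrite !updE /= CL // cats0 upd_upd.
pose g j := upd (upd (upd s rXC rest) rA (unary j))
  rVV (rev (flat_cells (nseq (inputs C - j) unknown))).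
apply: run_seq.
  have -> : upd (upd s rXC rest) rA (unary (inputs C)) = g (inputs C).
    by rewrite /g subnn; upd_eq; rewrite ?CL.
  apply: run_while_nat => //; first by lia.
  move=> j lj; rewrite {1}/g updE; split=> //.
  apply: run_seq (run_pop _ _ _) _.
  apply: run_eq (run_write_cell _ _ _) _; rewrite /g.
  have -> : inputs C - j = (inputs C - j.+1).+1 by lia.
  have -> m : nseq m.+1 unknown = rcons (nseq m unknown) unknown by elim: m => //= m ->.
  by rewrite rev_flat_cells_rcons; upd_eq.
rewrite /g subn0.
set cs0 := nseq _ _.
apply: run_seq (run_copy _ _ _ _ _) _; rewrite ?updE ?CL ?eW //.
pose h (u v : seq (nat * nat)) := upd (upd (upd s rXC rest) rW (enc_word v))
  rVV (rev (flat_cells (paints u cs0))).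
apply: run_seq.
  rewrite cats0.
  have -> : upd (upd (upd (upd s rXC rest) rA (unary 0)) rVV (rev (flat_cells cs0)))
    rW (enc_word ps) = h [::] ps.
    by rewrite /h /=; upd_eq; rewrite ?CL.
  apply: (@run_while_seq _ _ _ _ h) => //.
  move=> u x v ep; rewrite /h updE; split.
    by rewrite /enc_word /= /enc_pair; case: (x.1).
  have /andP [l1 l2] : (x.1 < N) && (x.2 < N).
    by apply: (allP lp); rewrite ep mem_cat mem_head orbT.
  apply: run_seq.
    apply: (@run_read_unary _ _ _ _ x.1 (enc_nat x.2 ++ enc_word v));
      rewrite ?updE ?CL //.
    by rewrite /enc_word /= /enc_pair -catA.
  apply: run_seq.
    by apply: (@run_read_unary _ _ _ _ x.2 (enc_word v)); rewrite ?updE ?CL.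
  apply: run_eq.
    apply: (@run_paint _ (paints u cs0) x.1 x.2);
      rewrite ?updE /= ?CL ?cats0 ?(ltnW l1) ?(ltnW l2) //.
    by rewrite size_paints size_nseq; lia.
  rewrite /paints foldl_rcons -/(paints _ _).
  by upd_eq; rewrite ?CL.
have sz : size (paints ps cs0) = inputs C by rewrite size_paints size_nseq.
apply: run_eq.
  apply: (@run_eval _ (paints ps cs0) (gates C) (output C));
    rewrite /h ?updE /= ?CL ?sz //.
  move=> u x v eg; split.
    by move: lg; rewrite eg all_cat /= => /and3P [].
  have lu : size u < size (gates C) by rewrite eg size_cat /=; lia.
  have := wg _ lu; rewrite eg nth_cat ltnn subnn /=.
  by case/and3P.
by rewrite /h /word_badness; upd_eq; rewrite ?CL.
Qed.

End Check.

(** * Enumerating words *)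

Definition enc_words (ws : seq (seq (nat * nat))) : seq bool :=
  flatten [seq enc_word w | w <- ws].

(** The reversal is the order in which a stack collects the new words, so that the program produces
    exactly the encoding of this list. *)
Definition extend (L : seq (nat * nat)) (T : seq (seq (nat * nat))) :=
  rev [seq l :: w | w <- T, l <- L].

Definition unpair (w : seq (nat * nat)) : seq nat :=
  flatten [seq [:: p.1; p.2] | p <- w].

Lemma enc_word_unpair w : enc_word w = flatten [seq enc_nat v | v <- unpair w].
Proof. by elim: w => //= p w IH; rewrite /enc_word /= {1}/enc_pair -!catA -IH. Qed.

Lemma size_unpair w : size (unpair w) = (size w).*2.
Proof. by elim: w => //= p w ->. Qed.

Lemma enc_seq_unpair w : enc_seq enc_nat (unpair w) = enc_nat (size w).*2 ++ enc_word w.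
Proof. by rewrite /enc_seq size_unpair enc_word_unpair. Qed.

Lemma size_enc_nat v : size (enc_nat v) = v.+1.
Proof. by rewrite /enc_nat size_rcons size_nseq. Qed.

Lemma enc_word_cons p w : enc_word (p :: w) = enc_nat p.1 ++ enc_nat p.2 ++ enc_word w.
Proof. by rewrite /enc_word /= /enc_pair -catA. Qed.

Lemma enc_word_cat w w' : enc_word (w ++ w') = enc_word w ++ enc_word w'.
Proof. by rewrite /enc_word map_cat flatten_cat. Qed.

Lemma size_enc_word_ge w : size w <= size (enc_word w).
Proof.
elim: w => //= p w IH; rewrite enc_word_cons !size_cat !size_enc_nat.
by lia.
Qed.

Lemma enc_word_bound w : all (fun p => (p.1 < size (enc_word w)) &&
  (p.2 < size (enc_word w))) w.
Proof.
apply/allP => p pw; elim: w pw => //= q w IH.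
rewrite enc_word_cons !size_cat !size_enc_nat inE => /orP [/eqP <-|/IH /andP []]; lia.
Qed.

(** Bounds the rounds of a loop over words by the size of their encoding; an empty word would leave
    no trace in it. *)
Lemma size_enc_words_ge ws : all (fun w => 0 < size w) ws ->
  size ws <= size (enc_words ws).
Proof.
elim: ws => //= w ws IH /andP [l /IH le]; rewrite /enc_words /= size_cat.
have := size_enc_word_ge w; rewrite -/(enc_words ws); lia.
Qed.

Arguments push_ones : simpl never.

Section Main.
Variable N : nat.
Notation run := (run N).

Fixpoint read_pairs m r a : prog :=
  if m is m'.+1 then read_nat r a ;; read_nat r a ;; read_pairs m' r a else Skip.

Lemma run_read_pairs r a s ps u :
  r != a -> r != rFL -> a != rFL -> s rFL = [::] -> size (s r) <= N ->
  s r = enc_word ps ++ u ->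
  run (read_pairs (size ps) r a) s (upd (upd s r u) a (rev (enc_word ps) ++ s a)).
Proof.
move=> ne nr na eF; elim: ps s eF => [|p ps IH] s eF le e /=.
  have -> : u = s r by rewrite e.
  by rewrite !upd_id; apply: run_skip.
rewrite enc_word_cons -!catA in e; move: le; rewrite e !size_cat !size_enc_nat => le.
apply: run_seq; first by apply: run_read_nat e => //; lia.
apply: run_seq.
  by apply: (@run_read_nat _ _ _ _ p.2 (enc_word ps ++ u));
    rewrite ?updE; neqs => //; lia.
apply: run_eq.
  by apply: IH; rewrite !updE; neqs => //; rewrite size_cat; lia.
by rewrite enc_word_cons !rev_cat -!catA; upd_eq.
Qed.

(** Words are stored without separators, so their common length [m] is built into the program. This
    is harmless, because all lengths depend on [D] only. *)
Definition extend_prog m : prog :=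
  While rT (read_pairs m rT rW ;; transfer rW rW2 ;; copy rLT rL2 ;;
    While rL2 (copy rW2 rT2 ;; read_pairs 1 rL2 rW ;; transfer rW rT2) ;; clear rW2) ;;
  transfer rT2 rW ;; transfer rW rT.

Lemma run_extend m s L T :
  s rTMP = [::] -> s rFL = [::] -> s rW = [::] -> s rW2 = [::] -> s rL2 = [::] ->
  s rT2 = [::] -> s rLT = enc_word L -> s rT = enc_words T ->
  0 < m -> all (fun w => size w == m) T ->
  size (enc_word L) <= N -> size (enc_words T) <= N ->
  size (enc_words (extend L T)) <= N ->
  run (extend_prog m) s (upd s rT (enc_words (extend L T))).
Proof.
move=> eTMP eF eW eW2 eL2 eT2 eLT eT m0 am lL lT lE.
pose g (u v : seq (seq (nat * nat))) :=
  upd (upd s rT (enc_words v)) rT2 (enc_words (extend L u)).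
apply: run_seq.
  have -> : s = g [::] T by rewrite /g; upd_eq.
  apply: (@run_while_seq _ _ _ _ g).
  - apply: leq_trans lT; apply: size_enc_words_ge; apply: sub_all am => w /eqP ->.
    exact: m0.
  - by rewrite /g updE.
  move=> u w v eTT; have sw : size w = m.
    by move: am; rewrite eTT all_cat /= => /and3P [_ /eqP].
  have lw : size (enc_words (w :: v)) <= N.
    by apply: leq_trans lT; rewrite eTT /enc_words map_cat flatten_cat size_cat
      leq_addl.
  have lw' : size (enc_word w) <= N.
    by apply: leq_trans lw; rewrite /enc_words /= size_cat leq_addr.
  split.
    rewrite /g updE /= /enc_words /=; case: (w) sw => [|p w'] /=.
      by move=> e; rewrite -e in m0.
    by move=> _; rewrite enc_word_cons; case: (p.1).
  rewrite /g -sw; apply: run_seq.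
    by apply: (@run_read_pairs _ _ _ w (enc_words v)); rewrite ?updE.
  rewrite !updE /= eW cats0.
  apply: run_seq.
    by apply: run_transfer; rewrite ?updE //= size_rev.
  rewrite !updE /= eW2 revK cats0.
  apply: run_seq.
    by apply: run_copy; rewrite ?updE //= eLT.
  rewrite !updE /= eLT eL2 cats0.
  set s1 := (X in run _ X _).
  pose h (u' v' : seq (nat * nat)) := upd (upd s1 rL2 (enc_word v'))
    rT2 (enc_words (rev [seq l :: w | l <- u'] ++ extend L u)).
  apply: run_seq.
    have -> : s1 = h [::] L by rewrite /h /s1 /=; upd_eq.
    apply: (@run_while_seq _ _ _ _ h).
    - exact: leq_trans (size_enc_word_ge _) lL.
    - by rewrite /h updE.
    move=> u' l v' eL; split.
      by rewrite /h updE enc_word_cons; case: (l.1).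
    rewrite /h /s1; apply: run_seq.
      by apply: run_copy; rewrite ?updE.
    apply: run_seq.
      apply: (@run_read_pairs _ _ _ [:: l] (enc_word v')); rewrite ?updE //=.
        apply: leq_trans lL; rewrite eL enc_word_cat size_cat leq_addl //.
      by rewrite -enc_word_cat.
    apply: run_eq.
      apply: run_transfer; rewrite ?updE //= cats0 size_rev.
      apply: leq_trans lL; rewrite eL -cat_rcons -cats1 !enc_word_cat !size_cat.
      by lia.
    rewrite map_rcons rev_rcons; upd_eq.
    by rewrite cats0 revK /enc_words /= !enc_word_cons -!catA.
  apply: run_eq.
    by apply: run_clear; rewrite /h /s1 !updE.
  have -> : extend L (rcons u w) = rev [seq l :: w | l <- L] ++ extend L u.
    by rewrite /extend -cats1 allpairs_cat rev_cat /= cats0.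
  by rewrite /h /s1; upd_eq.
rewrite /g; apply: run_seq; first by apply: run_transfer; rewrite ?updE.
apply: run_eq.
  by apply: run_transfer; rewrite ?updE //= eW cats0 size_rev.
by upd_eq; rewrite eW !cats0 ?revK.
Qed.

Fixpoint extend_n_prog c m : prog := if c is c'.+1 then extend_prog m ;;
  extend_n_prog c' m.+1 else Skip.

Lemma size_extend L T m : all (fun w => size w == m) T -> all (fun w =>
  size w == m.+1) (extend L T).
Proof.
move=> /allP h; apply/allP => w; rewrite mem_rev => /allpairsP [[w' l] [/= h1 _ ->]].
by rewrite /= eqSS; apply: h.
Qed.

Lemma run_extend_n c m s L T :
  s rTMP = [::] -> s rFL = [::] -> s rW = [::] -> s rW2 = [::] -> s rL2 = [::] ->
  s rT2 = [::] -> s rLT = enc_word L -> s rT = enc_words T ->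
  0 < m -> all (fun w => size w == m) T ->
  size (enc_word L) <= N ->
  (forall j, j <= c -> size (enc_words (iter j (extend L) T)) <= N) ->
  run (extend_n_prog c m) s (upd s rT (enc_words (iter c (extend L) T))).
Proof.
move=> eTMP eF eW eW2 eL2 eT2 eLT; elim: c m s T eTMP eF eW eW2 eL2 eT2 eLT
  => [|c IH] m s T eTMP eF eW eW2 eL2 eT2 eLT eT m0 am lL lT /=.
  by rewrite -eT upd_id; apply: run_skip.
apply: run_seq.
  by apply: (run_extend (L := L) (T := T)) => //; [apply: (lT 0) | apply: (lT 1)].
apply: run_eq.
  apply: (IH _ _ (extend L T)); rewrite ?updE //.
    exact: size_extend.
  by move=> j lj; rewrite -iterSr; apply: lT.
by rewrite upd_upd -iterSr.
Qed.

Definition segments nn := flatten [seq [seq (a, b) | a <- iota 0 b] | b <- iota 1 nn].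
Definition steps k := [seq (i, i.+1) | i <- iota 0 k.+1].

Definition list_segments : prog :=
  copy rNN rB ;;
  While rB (copy rB rA ;;
    While rA (pop rA ;; Push rLT false ;; copy rB rLT ;; Push rLT false ;;
      copy rA rLT) ;;
    pop rB).

Lemma enc_nat_cat v w : enc_nat v ++ w = unary v ++ false :: w.
Proof. by rewrite /enc_nat cat_rcons. Qed.

Lemma unary_true v w : unary v ++ true :: w = true :: unary v ++ w.
Proof. by elim: v => //= v ->. Qed.

Lemma iota_sub i b : i < b -> iota i (b - i) = i :: iota i.+1 (b - i.+1).
Proof. by move=> l; rewrite -[b - i]prednK ?subn_gt0 // -subnS. Qed.

Lemma run_list_segments nn s :
  s rTMP = [::] -> s rA = [::] -> s rB = [::] -> s rLT = [::] ->
  s rNN = unary nn -> nn <= N ->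
  run list_segments s (upd s rLT (enc_word (segments nn))).
Proof.
move=> eTMP eA eB eLT eNN le.
(* A stack is filled from the end of the list, so the loops count down: with [j] rounds left, the
   pairs with right end point above [j] are present. *)
pose vl j := flatten [seq [seq (a, b) | a <- iota 0 b] | b <- iota j.+1 (nn - j)].
pose g j := upd (upd s rB (unary j)) rLT (enc_word (vl j)).
apply: run_seq; first by apply: run_copy; rewrite // eNN size_nseq.
rewrite eNN eB cats0.
have -> : upd s rB (unary nn) = g nn by rewrite /g /vl subnn; upd_eq.
have -> : upd s rLT (enc_word (segments nn)) = g 0.
  by rewrite /g /vl subn0; upd_eq.
apply: run_while_nat => // b lb; split; first by rewrite /g updE.
apply: run_seq; first by apply: run_copy; rewrite /g ?updE //= size_nseq; lia.
pose h i := upd (upd (g b.+1) rA (unary i)) rLT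
   (enc_word ([seq (a, b.+1) | a <- iota i (b.+1 - i)] ++ vl b.+1)).
apply: run_seq.
  have -> : upd (g b.+1) rA (g b.+1 rB ++ g b.+1 rA) = h b.+1.
    by rewrite /h /g subnn; upd_eq; rewrite eA cats0.
  apply: run_while_nat => //; first by lia.
  move=> i li; split; first by rewrite /h updE.
  apply: run_seq (run_pop _ _ _) _; rewrite /h /g.
  apply: run_seq (run_push _ _ _ _) _.
  apply: run_seq; first by apply: run_copy; rewrite ?updE //= size_nseq; lia.
  apply: run_seq (run_push _ _ _ _) _.
  apply: run_eq; first by apply: run_copy; rewrite ?updE //= size_nseq; lia.
  rewrite (iota_sub li) /= enc_word_cons !enc_nat_cat /=.
  by upd_eq.
rewrite /h /g; apply: run_eq (run_pop _ _ _) _.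
rewrite subn0; upd_eq => //.
by rewrite /vl (_ : nn - b = (nn - b.+1).+1) //; lia.
Qed.

Definition list_steps : prog :=
  copy rK rA ;; Push rA true ;;
  While rA (pop rA ;; Push rLT false ;; Push rLT true ;; copy rA rLT ;;
            Push rLT false ;; copy rA rLT).

Lemma run_list_steps k s :
  s rTMP = [::] -> s rA = [::] -> s rLT = [::] -> s rK = unary k -> k < N ->
  run list_steps s (upd s rLT (enc_word (steps k))).
Proof.
move=> eTMP eA eLT eK le.
pose h i := upd (upd s rA (unary i)) rLT
   (enc_word [seq (a, a.+1) | a <- iota i (k.+1 - i)]).
apply: run_seq; first by apply: run_copy; rewrite // eK size_nseq ltnW.
apply: run_seq (run_push _ _ _ _) _; rewrite eK eA cats0 updE /= upd_upd.
have -> : upd s rA (true :: unary k) = h k.+1 by rewrite /h subnn; upd_eq.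
have -> : upd s rLT (enc_word (steps k)) = h 0.
  by rewrite /h /steps subn0; upd_eq.
apply: run_while_nat => // i li; split; first by rewrite /h updE.
apply: run_seq (run_pop _ _ _) _; rewrite /h.
apply: run_seq (run_push _ _ _ _) _.
apply: run_seq (run_push _ _ _ _) _.
apply: run_seq; first by apply: run_copy; rewrite ?updE //= size_nseq; lia.
apply: run_seq (run_push _ _ _ _) _.
apply: run_eq; first by apply: run_copy; rewrite ?updE //= size_nseq; lia.
rewrite (iota_sub li) /= enc_word_cons !enc_nat_cat /=.
by upd_eq; rewrite unary_true.
Qed.

(** The encoding is pushed back to front: the entries of an accepted word, then its length [m.*2] as
    a tuple, and after the loop the number of tuples. Acceptance means that [rN1] is empty. *)
Definition filter_prog m : prog :=
  While rT (read_pairs m rT rW ;; transfer rW rW2 ;; check_prog ;;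
    Case rN1 (copy rW2 rR ;; Push rR false ;; push_ones rR m.*2 ;; Push rCR true)
      (clear rN1) Skip ;;
    clear rW2) ;;
  Push rR false ;; copy rCR rR.

Definition good_words C T := rev [seq w <- T | word_badness C w == 0].

Lemma run_filter m s C T :
  (forall r, r \in scratch -> s r = [::]) ->
  s rX = enc_circuit C -> s rW2 = [::] -> s rR = [::] -> s rCR = [::] ->
  s rT = enc_words T -> wf_circuit C ->
  (inputs C + size (gates C)).*2 <= N ->
  all (fun g => size (preds g) < N) (gates C) ->
  size (enc_circuit C) <= N -> size (enc_words T) <= N ->
  (forall w, w \in T -> word_badness C w <= N) ->
  0 < m -> all (fun w => size w == m) T ->
  run (filter_prog m) s
    (upd (upd (upd s rT [::])
       rR (enc_seq (enc_seq enc_nat) (map unpair (good_words C T))))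
       rCR (unary (size (good_words C T)))).
Proof.
move=> cl eX eW2 eR eCR eT wf le lg lX lT lb m0 am.
have CL := (cl rTMP isT, cl rFL isT, cl rW isT, cl rN1 isT).
pose fl u := flatten [seq enc_seq enc_nat i | i <- map unpair (good_words C u)].
pose g (u v : seq (seq (nat * nat))) := upd (upd (upd s rT (enc_words v))
   rR (fl u)) rCR (unary (size (good_words C u))).
have lsT : size T <= N.
  apply: leq_trans lT; apply: size_enc_words_ge; apply: sub_all am => w /eqP ->.
  exact: m0.
apply: run_seq.
  have -> : s = g [::] T by rewrite /g /fl /=; upd_eq.
  apply: (@run_while_seq _ _ _ _ g) => //.
  move=> u w v eTT; have sw : size w = m.
    by move: am; rewrite eTT all_cat /= => /and3P [_ /eqP].
  have lw : size (enc_words (w :: v)) <= N.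
    by apply: leq_trans lT; rewrite eTT /enc_words map_cat flatten_cat size_cat
      leq_addl.
  have lw' : size (enc_word w) <= N.
    by apply: leq_trans lw; rewrite /enc_words /= size_cat leq_addr.
  split.
    rewrite /g updE /= /enc_words /=; case: (w) sw => [|p w'] /=.
      by move=> e; rewrite -e in m0.
    by move=> _; rewrite enc_word_cons; case: (p.1).
  rewrite /g; apply: run_seq.
    by rewrite -{1}sw; apply: (@run_read_pairs _ _ _ w (enc_words v));
      rewrite ?updE //= ?CL.
  rewrite !updE /= CL cats0.
  apply: run_seq; first by apply: run_transfer; rewrite ?updE //= size_rev.
  rewrite !updE /= eW2 revK cats0.
  apply: run_seq.
    apply: (@run_check _ _ C w) => //.
    - move=> r hr; have := cl r hr; move: hr; rewrite !inE.
      by do 13! [case/predU1P => [->//|]]; move/eqP => ->.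
    - apply/allP => p /(allP (enc_word_bound w)) /andP [l1 l2].
      by rewrite (leq_trans l1) // (leq_trans l2).
    - exact: leq_trans (size_enc_word_ge _) lw'.
  rewrite -cats1 /fl /good_words filter_cat rev_cat /=.
  case eb: (word_badness C w) => [|b] /=.
    apply: run_seq.
      apply: run_caseN; first by rewrite updE.
      apply: run_seq; first by apply: run_copy; rewrite ?updE //= CL.
      apply: run_seq (run_push _ _ _ _) _.
      apply: run_seq (run_push_ones _ _ _ _) _.
      exact: run_push.
    apply: run_eq; first by apply: run_clear; rewrite ?updE.
    by rewrite enc_seq_unpair sw enc_nat_cat; upd_eq; rewrite ?CL -?catA.
  apply: run_seq.
    apply: run_caseC; first by rewrite updE.
    apply: run_clear; rewrite ?updE /= size_nseq.
    have := lb w; rewrite eb eTT mem_cat mem_head orbT => /(_ isT); lia.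
  apply: run_eq; first by apply: run_clear; rewrite ?updE.
  by upd_eq; rewrite ?CL.
rewrite /g; apply: run_seq (run_push _ _ _ _) _.
apply: run_eq.
  apply: run_copy; rewrite ?updE ?CL //= size_nseq size_rev size_filter.
  exact: leq_trans (count_size _ _) lsT.
by rewrite /enc_seq size_map enc_nat_cat; upd_eq.
Qed.

Definition constraints_prog m : prog :=
  While rT (read_pairs m rT rW ;; copy rR rOUT ;; transfer rW rOUT ;; Push rOUT false ;;
    push_ones rOUT m.*2 ;; copy rNB rNBS ;; Push rCN true).

Lemma run_constraints m s T RE NBE :
  s rTMP = [::] -> s rFL = [::] -> s rW = [::] ->
  s rOUT = [::] -> s rNBS = [::] -> s rCN = [::] ->
  s rT = enc_words T -> s rR = RE -> s rNB = NBE ->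
  size (enc_words T) <= N -> size RE <= N -> size NBE <= N ->
  0 < m -> all (fun w => size w == m) T ->
  run (constraints_prog m) s
    (upd (upd (upd (upd s rT [::])
       rOUT (flatten [seq enc_seq enc_nat (unpair w) ++ RE | w <- rev T]))
       rNBS (flatten (nseq (size T) NBE))) rCN (unary (size T))).
Proof.
move=> eTMP eF eW eO eS eC eT eR eB lT lR lB m0 am.
pose g (u v : seq (seq (nat * nat))) := (upd (upd (upd (upd s rT (enc_words v))
       rOUT (flatten [seq enc_seq enc_nat (unpair w) ++ RE | w <- rev u]))
       rNBS (flatten (nseq (size u) NBE))) rCN (unary (size u))).
have -> : s = g [::] T by rewrite /g /=; upd_eq.
apply: run_eq; first apply: (@run_while_seq _ _ _ _ g) => //.
- apply: leq_trans lT; apply: size_enc_words_ge; apply: sub_all am => w /eqP ->.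
  exact: m0.
- move=> u w v eTT; have sw : size w = m.
    by move: am; rewrite eTT all_cat /= => /and3P [_ /eqP].
  have lw : size (enc_words (w :: v)) <= N.
    by apply: leq_trans lT; rewrite eTT /enc_words map_cat flatten_cat size_cat
      leq_addl.
  have lw' : size (enc_word w) <= N.
    by apply: leq_trans lw; rewrite /enc_words /= size_cat leq_addr.
  split.
    rewrite /g updE /= /enc_words /=; case: (w) sw => [|p w'] /=.
      by move=> e; rewrite -e in m0.
    by move=> _; rewrite enc_word_cons; case: (p.1).
  rewrite /g; apply: run_seq.
    by rewrite -{1}sw; apply: (@run_read_pairs _ _ _ w (enc_words v)); rewrite ?updE.
  rewrite !updE /= eW cats0.
  apply: run_seq; first by apply: run_copy; rewrite ?updE //= eR.
  apply: run_seq; first by apply: run_transfer; rewrite ?updE //= size_rev.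
  apply: run_seq (run_push _ _ _ _) _.
  apply: run_seq (run_push_ones _ _ _ _) _.
  apply: run_seq; first by apply: run_copy; rewrite ?updE //= eB.
  apply: run_eq (run_push _ _ _ _) _.
  rewrite rev_rcons size_rcons /= enc_seq_unpair sw enc_nat_cat /=; upd_eq.
  - by rewrite eB.
  - by rewrite revK eR -!catA.
by rewrite /g; upd_eq.
Qed.

Definition neighbours_prog : prog :=
  copy rNV rA ;; While rA (pop rA ;; Push rNB false ;; copy rA rNB) ;;
  Push rNB false ;; copy rNV rNB.

Lemma run_neighbours n s : s rTMP = [::] -> s rA = [::] -> s rNB = [::] ->
  s rNV = unary n -> n <= N ->
  run neighbours_prog s (upd s rNB (enc_seq enc_nat (iota 0 n))).
Proof.
move=> eTMP eA eB eV le.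
pose h i := upd (upd s rA (unary i)) rNB (flatten (map enc_nat (iota i (n - i)))).
apply: run_seq; first by apply: run_copy; rewrite // eV size_nseq.
rewrite eV eA cats0; apply: run_seq.
  have -> : upd s rA (unary n) = h n by rewrite /h subnn; upd_eq.
  apply: run_while_nat => // i li; split; first by rewrite /h updE.
  apply: run_seq (run_pop _ _ _) _; rewrite /h.
  apply: run_seq (run_push _ _ _ _) _.
  apply: run_eq; first by apply: run_copy; rewrite ?updE //= size_nseq; lia.
  by rewrite (iota_sub li) /= enc_nat_cat; upd_eq.
rewrite /h; apply: run_seq (run_push _ _ _ _) _.
apply: run_eq; first by apply: run_copy; rewrite ?updE //= eV size_nseq.
by rewrite /enc_seq size_iota enc_nat_cat subn0; upd_eq; rewrite eV.
Qed.

(* Variables [0 .. k.+1] are the end points of the segments, the next ones guess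
   the end points of [c] segments. *)
Fixpoint guess_word k c : seq (nat * nat) :=
  if c is c'.+1 then (k + c'.*2.+3, k + c'.*2.+2) :: guess_word k c' else [:: (k.+1,
    0)].

Fixpoint push_guess_word c : prog :=
  if c is c'.+1 then
    push_guess_word c' ;; Push rT false ;; push_ones rT c'.*2.+2 ;; copy rK rT ;;
    Push rT false ;; push_ones rT c'.*2.+3 ;; copy rK rT
  else Push rT false ;; Push rT false ;; Push rT true ;; copy rK rT.

Lemma size_guess_word k c : size (guess_word k c) = c.+1.
Proof. by elim: c => //= c ->. Qed.

Lemma unaryD a b : unary (a + b) = unary a ++ unary b.
Proof. exact: nseqD. Qed.

Lemma run_push_guess_word k c s : s rTMP = [::] -> s rT = [::] -> s rK = unary k ->
  k <= N ->
  run (push_guess_word c) s (upd s rT (enc_word (guess_word k c))).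
Proof.
move=> eTMP eT eK le; elim: c => [|c IH] /=.
  do 3! apply: run_seq (run_push _ _ _ _) _.
  apply: run_eq; first by apply: run_copy; rewrite ?updE //= eK size_nseq.
  by upd_eq; rewrite eT eK enc_word_cons /= !enc_nat_cat /= -unary_true.
apply: run_seq IH _.
apply: run_seq (run_push _ _ _ _) _.
apply: run_seq (run_push_ones _ _ _ _) _.
apply: run_seq; first by apply: run_copy; rewrite ?updE //= eK size_nseq.
apply: run_seq (run_push _ _ _ _) _.
apply: run_seq (run_push_ones _ _ _ _) _.
apply: run_eq; first by apply: run_copy; rewrite ?updE //= eK size_nseq.
by rewrite enc_word_cons !enc_nat_cat !unaryD -!catA; upd_eq; rewrite eK.
Qed.

End Main.

(** * The reduction as a program *)

(* The last pair [(n.+1, 0)] gives the values of the end points [k.+1] and [0];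
   read as a segment it is empty, so it needs no special treatment. *)
Definition candidates D n := iter D.*2 (extend (segments n.+1)) [:: [:: (n.+1, 0)]].
Definition scopes D k := iter D (extend (steps k)) [:: guess_word k D].
Definition red_vars D k := k + D.*2.+2.
Definition red_rel D C := map unpair (good_words C (candidates D (inputs C))).

(** All constraints share one relation and differ only in the segments they inspect. The values are
    the possible end points [0 .. n.+1]. *)
Definition red_csp D C k :=
  CSP (red_vars D k) (inputs C).+2 [seq (unpair w, red_rel D C) | w <- rev (scopes D
    k)].

Definition red_nb D k := nseq (size (scopes D k)) (iota 0 (red_vars D k)).

Definition enc_rel D C := enc_seq (enc_seq enc_nat) (red_rel D C).
Definition enc_nbs D k := enc_seq enc_nat (iota 0 (red_vars D k)).

Lemma enc_redE D C k :
  enc_csp_bigraph (red_csp D C k, red_nb D k) =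
  enc_nat (red_vars D k) ++ enc_nat (inputs C).+2 ++
  enc_nat (size (scopes D k)) ++
  flatten [seq enc_seq enc_nat (unpair w) ++ enc_rel D C | w <- rev (scopes D k)] ++
  enc_nat (size (scopes D k)) ++
  flatten (nseq (size (scopes D k)) (enc_nbs D k)).
Proof.
rewrite /enc_csp_bigraph /enc_pair /= -!catA; congr (_ ++ (_ ++ _)).
rewrite size_map size_rev -map_comp; congr (_ ++ (_ ++ _)).
by rewrite /red_nb /enc_seq size_nseq map_nseq.
Qed.

Section Main.
Variable N : nat.
Notation run := (run N).

Definition prepend_nat a b : prog := Push b false ;; copy a b.

Lemma run_prepend_nat a b s v :
  a != b -> a != rTMP -> b != rTMP -> s rTMP = [::] -> s a = unary v -> v <= N ->
  run (prepend_nat a b) s (upd s b (enc_nat v ++ s b)).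
Proof.
move=> ne na nb e ea le; apply: run_seq (run_push _ _ _ _) _.
have ea' : upd s b (false :: s b) a = unary v by rewrite updE (negbTE ne).
apply: run_eq; first by apply: run_copy; rewrite ?ea' ?size_nseq // updE; neqs.
by rewrite ea' updE eqxx upd_upd enc_nat_cat.
Qed.

(** The output is assembled on [rNBS] from its last component to its first; the detour through [rW]
    keeps the constraints in order. The mark pushed on [rNN] turns [n.+1] into the number of
    values. *)
Definition output_prog : prog :=
  clear rX ;; clear rK ;; prepend_nat rCN rNBS ;; transfer rOUT rW ;;
    transfer rW rNBS ;;
  prepend_nat rCN rNBS ;; Push rNN true ;; prepend_nat rNN rNBS ;;
    prepend_nat rNV rNBS ;;
  copy rNBS rX ;; copy rNV rK.

Lemma run_output s c nn v O B :
  s rTMP = [::] -> s rW = [::] -> s rOUT = O -> s rNBS = B -> s rCN = unary c ->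
  s rNN = unary nn -> s rNV = unary v -> size (s rX) <= N -> size (s rK) <= N ->
  let w := enc_nat v ++ enc_nat nn.+1 ++ enc_nat c ++ O ++ enc_nat c ++ B in
  size w <= N ->
  exists2 s', run output_prog s s' & s' rX = w /\ s' rK = unary v.
Proof.
move=> eTMP eW eO eB eC eN eV lX lK w; rewrite /w !size_cat !size_enc_nat => lw.
pose t b := upd (upd (upd s rX [::]) rK [::]) rNBS b.
pose t1 b := upd (upd (t b) rOUT [::]) rNN (unary nn.+1).
exists (upd (upd (t1 w) rX w) rK (unary v)); last by rewrite !updE.
apply: run_seq; first exact: run_clear.
apply: run_seq; first by apply: run_clear; rewrite updE.
apply: (run_seq (s2 := t (enc_nat c ++ B))).
  apply: run_eq; first by apply: (@run_prepend_nat _ _ _ c) => //; lia.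
  by rewrite /t !updE /= eB.
apply: (run_seq (s2 := upd (upd (t (enc_nat c ++ B)) rW (rev O)) rOUT [::])).
  apply: run_eq; first by apply: run_transfer; rewrite /t ?updE //= eO; lia.
  by rewrite /t !updE /= eO eW cats0.
apply: (run_seq (s2 := upd (t (O ++ enc_nat c ++ B)) rOUT [::])).
  apply: run_eq; first by apply: run_transfer; rewrite /t ?updE //= size_rev; lia.
  by rewrite /t !updE /= revK; upd_eq.
apply: (run_seq (s2 := upd (t (enc_nat c ++ O ++ enc_nat c ++ B)) rOUT [::])).
  apply: run_eq; first by apply: (@run_prepend_nat _ _ _ c); rewrite /t ?updE //; lia.
  by rewrite /t; upd_eq.
apply: (run_seq (s2 := t1 (enc_nat c ++ O ++ enc_nat c ++ B))).
  by apply: run_eq (run_push _ _ _ _) _; rewrite /t1 /t !updE /= eN.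
apply: (run_seq (s2 := t1 (enc_nat nn.+1 ++ enc_nat c ++ O ++ enc_nat c ++ B))).
  apply: run_eq; first by apply: (@run_prepend_nat _ _ _ nn.+1);
    rewrite /t1 /t ?updE //; lia.
  by rewrite /t1 /t; upd_eq.
apply: (run_seq (s2 := t1 w)).
  apply: run_eq; first by apply: (@run_prepend_nat _ _ _ v); rewrite /t1 /t ?updE //;
    lia.
  by rewrite /t1 /t; upd_eq.
apply: (run_seq (s2 := upd (t1 w) rX w)).
  apply: run_eq.
    by apply: run_copy; rewrite /t1 /t ?updE //= /w !size_cat !size_enc_nat.
  by rewrite /t1 /t; upd_eq; rewrite cats0.
apply: run_eq; first by apply: run_copy; rewrite /t1 /t ?updE //= eV size_nseq; lia.
by rewrite /t1 /t; upd_eq; rewrite eV cats0.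
Qed.

Definition build_prog D : prog :=
  (copy rX rXC ;; read_unary rXC rNN ;; Push rNN true ;; clear rXC) ;;
  list_segments ;; (Push rT false ;; Push rT false ;; copy rNN rT) ;;
  extend_n_prog D.*2 1 ;; filter_prog D.*2.+1 ;; clear rLT ;; list_steps ;;
    push_guess_word D ;;
  extend_n_prog D D.+1 ;; (copy rK rNV ;; push_ones rNV D.*2.+2) ;; neighbours_prog ;;
  constraints_prog D.*2.+1.

Definition reduction_prog D : prog := build_prog D ;; output_prog.

Lemma size_iter_extend_mem j L T m : all (fun w => size w == m) T ->
  all (fun w => size w == j + m) (iter j (extend L) T).
Proof. by move=> h; elim: j => //= j /size_extend. Qed.

Lemma run_reduction D C k :
  wf_circuit C ->
  (inputs C + size (gates C)).*2 <= N ->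
  all (fun g => size (preds g) < N) (gates C) ->
  size (enc_circuit C) <= N ->
  size (enc_word (segments (inputs C).+1)) <= N ->
  size (enc_word (steps k)) <= N ->
  (forall j, j <= D.*2 ->
     size (enc_words (iter j (extend (segments (inputs C).+1)) [:: [:: ((inputs
       C).+1, 0)]])) <= N) ->
  (forall j, j <= D ->
     size (enc_words (iter j (extend (steps k)) [:: guess_word k D])) <= N) ->
  size (enc_rel D C) <= N -> size (enc_nbs D k) <= N ->
  size (enc_csp_bigraph (red_csp D C k, red_nb D k)) <= N ->
  exists2 s, run (reduction_prog D) (init (enc_circuit C) (unary k)) s &
    s 0 = enc_csp_bigraph (red_csp D C k, red_nb D k) /\
    s 1 = unary (red_vars D k).
Proof.
move=> wf le lg lX lV lI lT lS lR lN lO.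
have lnn : (inputs C).+1 <= N by have [wo _] := wf; move: wo le; rewrite -addnn; lia.
have lv : red_vars D k <= N.
  by apply: leq_trans lO; rewrite enc_redE size_cat size_enc_nat; lia.
have lk : k < N by move: lv; rewrite /red_vars; lia.
have lZ : size (scopes D k) <= N.
  by apply: leq_trans lO; rewrite enc_redE !size_cat !size_enc_nat; lia.
have zs j : all (fun w : seq (nat * nat) => size w == j + D.+1)
    (iter j (extend (steps k)) [:: guess_word k D]).
  by apply: size_iter_extend_mem; rewrite /= size_guess_word eqxx.
have ts : all (fun w : seq (nat * nat) => size w == D.*2.+1) (candidates D (inputs C)).
  by rewrite -addn1; apply: size_iter_extend_mem.
set s0 := init _ _.
pose s1 := upd s0 rNN (unary (inputs C).+1).
pose s2 := upd (upd s1 rR (enc_rel D C)) rCR (unary (size (good_words C (candidates D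
  (inputs C))))).
pose s3 := upd (upd (upd s2 rLT (enc_word (steps k))) rNV (unary (red_vars D k)))
   rNB (enc_nbs D k).
pose s4 := upd (upd (upd s3
       rOUT (flatten [seq enc_seq enc_nat (unpair w) ++ enc_rel D C | w <- rev
         (scopes D k)]))
       rNBS (flatten (nseq (size (scopes D k)) (enc_nbs D k)))) rCN (unary (size
         (scopes D k))).
suff h : run (build_prog D) s0 s4.
  have [s' h' [e0 e1]] : exists2 s', run output_prog s4 s' &
    s' rX = enc_csp_bigraph (red_csp D C k, red_nb D k) /\ s' rK = unary (red_vars D k).
    have := @run_output s4 (size (scopes D k)) (inputs C).+1 (red_vars D k).
    by rewrite enc_redE in lO *; apply=> //; rewrite size_nseq ltnW.
  by exists s' => //; apply: run_seq h h'.
set w0 := [:: [:: ((inputs C).+1, 0)]] in lT *.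
apply: (run_seq (s2 := s1)).
  apply: run_seq; first exact: run_copy.
  apply: run_seq.
    apply: (@run_read_unary _ _ _ _ (inputs C)
      (enc_seq enc_gate (gates C) ++ enc_nat (output C))) => //.
    by rewrite updE /= cats0 /enc_circuit /enc_pair /= -catA.
  apply: run_seq (run_push _ _ _ _) _.
  apply: run_eq.
    apply: run_clear; rewrite !updE /=.
    apply: leq_trans lX; rewrite /enc_circuit /enc_pair /= !size_cat; lia.
  by rewrite /s1; upd_eq; rewrite cats0.
apply: run_seq.
  by apply: (@run_list_segments _ (inputs C).+1).
apply: (run_seq (s2 := upd (upd s1 rLT (enc_word (segments (inputs C).+1))) rT
  (enc_words w0))).
  do 2! apply: run_seq (run_push _ _ _ _) _.
  apply: run_eq; first by apply: run_copy; rewrite ?updE //= size_nseq; lia.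
  rewrite /s1 /enc_words /= enc_word_cons !enc_nat_cat /=; upd_eq.
  by rewrite !cats0.
apply: run_seq.
  by apply: (run_extend_n (L := segments (inputs C).+1) (T := w0)).
rewrite upd_upd; apply: run_seq.
  apply: (@run_filter _ _ _ C (candidates D (inputs C))) => //.
  - by move=> r; rewrite !inE; do 13! [case/predU1P => [->//|]]; move/eqP => ->.
  - by apply: lT.
  - move=> w _; rewrite /word_badness /badness.
    have sz : size (circuit_cells C w) = inputs C + size (gates C).
      by rewrite size_node_values size_paints size_nseq.
    have := count_size (fun c => c.1 && c.2) (circuit_cells C w); rewrite sz.
    have : nat_of_bool (~~ (nth unknown (circuit_cells C w) (output C)).1) <= 1 by
      case: (~~ _).
    by have [wo _] := wf; move: wo le; rewrite -addnn; lia.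
apply: (run_seq (s2 := s2)).
  apply: run_eq; first by apply: run_clear; rewrite !updE.
  by rewrite /s2 /enc_rel /red_rel; upd_eq.
apply: run_seq; first by apply: (@run_list_steps _ k).
apply: run_seq; first by apply: (@run_push_guess_word _ k); rewrite ?updE //=;
  exact: ltnW.
apply: run_seq.
  apply: (run_extend_n (L := steps k) (T := [:: guess_word k D])); rewrite ?updE //.
    by rewrite /enc_words /= cats0.
  by have := zs 0; rewrite add0n.
apply: (run_seq (s2 := upd (upd (upd s2 rLT (enc_word (steps k)))
    rNV (unary (red_vars D k))) rT (enc_words (scopes D k)))).
  apply: run_seq; first by apply: run_copy; rewrite ?updE //= size_nseq ltnW.
  apply: run_eq (run_push_ones _ _ _ _) _.
  rewrite /red_vars addnC unaryD; upd_eq; by rewrite cats0.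
apply: run_seq; first by apply: (@run_neighbours _ (red_vars D k)).
apply: run_eq.
  apply: (@run_constraints _ _ _ (scopes D k) (enc_rel D C) (enc_nbs D k));
    rewrite ?updE //=.
    by apply: lS.
  by have := zs D; rewrite addnS -addnn.
by rewrite /s4 /s3; upd_eq.
Qed.

End Main.

(** * Which inputs determine a node of weft at most one *)

Definition agrees (c : cell) (b : bool) : bool := (c.1 ==> b) && (c.2 ==> ~~ b).

Lemma agrees_swap s c b : agrees (swap_if s c) (b (+) s) = agrees c b.
Proof. by case: s b c => [] [] [[] []]. Qed.

Lemma known_swap s b : swap_if s (b, ~~ b) = (b (+) s, ~~ (b (+) s)).
Proof. by case: s b => [] []. Qed.

(** The Boolean counterpart of [cell_step], which lets the three kinds of gates be treated as one.
    NOT needs its arity because it reads only the head of the list. *)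
Lemma eval_gateE g bs :
  (kind g = NOT -> size bs = 1) ->
  eval_gate g bs = all id [seq b (+) negates_inputs (kind g) | b <- bs]
    (+) negates_output (kind g).
Proof.
rewrite /eval_gate; case: (kind g) => /= h.
- by case: bs {h} (h erefl) => [|b []] //= _; rewrite andbT addbF addbT.
- by rewrite addbF all_map; apply: eq_all => b /=; rewrite addbF.
- rewrite addbT -has_predC has_map; apply: eq_has => b /=; rewrite addbT negbK //.
Qed.

Section Core.
Variables (I : eqType) (c : I -> cell) (b : I -> bool) (s : seq I).
Hypothesis ok : {in s, forall i, agrees (c i) (b i)}.

(** Restricted to small conjunctions: for large ones the value [true] is a mere default. *)
Lemma conj_cells_sound : size s <= 2 -> agrees (conj_cells (map c s)) (all id (map b
  s)).
Proof.
rewrite /conj_cells size_map leqNgt => /negbTE -> /=; rewrite /agrees /= !all_map.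
apply/andP; split; apply/implyP.
  move=> /allP h; apply/allP => i si /=; have /andP [/implyP h1 _] := ok si.
  exact: h1 (h i si).
rewrite has_map => /hasP [i si /= ci]; apply/allPn; exists i => //=.
by have /andP [_ /implyP /(_ ci)] := ok si.
Qed.

(** No predecessor can be known to be false, so the default is right without anything being
    revealed. *)
Lemma conj_cells_large_true : 2 < size s -> all id (map b s) ->
  conj_cells (map c s) = (true, false).
Proof.
rewrite /conj_cells size_map => -> /=; rewrite all_map => /allP h.
suff -> : has snd (map c s) = false by [].
rewrite has_map; apply/hasPn => i si /=; have /andP [_ /implyP h2] := ok si.
by have /= bi := h i si; apply/negP => /h2; rewrite bi.
Qed.

Lemma conj_cells_large_false i : 2 < size s -> i \in s -> c i = (false, true) ->
  conj_cells (map c s) = (false, true).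
Proof.
rewrite /conj_cells size_map => -> /= si ci.
suff -> : has snd (map c s) by [].
by rewrite has_map; apply/hasP; exists i; rewrite //= ci.
Qed.

End Core.

Lemma conj_cells_known (I : eqType) (c : I -> cell) (b : I -> bool) (s : seq I) :
  size s <= 2 -> {in s, forall i, c i = (b i, ~~ b i)} ->
  conj_cells (map c s) = (all id (map b s), ~~ all id (map b s)).
Proof.
move=> le h; rewrite /conj_cells size_map ltnNge le /=.
have -> : map c s = [seq (b i, ~~ b i) | i <- s] by apply/eq_in_map.
by rewrite !all_map -has_predC !has_map.
Qed.

Section Kleene.
Variables (n : nat) (a : seq bool) (pos : nat -> nat).
Hypothesis sa : size a = n.

Definition sound (al : seq cell) : Prop :=
  size al = n /\ forall q, q < n -> agrees (nth unknown al q) (nth false a q).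

(** [pos] partitions the inputs into blocks, later the segments. Certificates count blocks, and a
    revealed block makes all its inputs exactly known. *)
Definition covers (K : seq nat) (al : seq cell) : Prop :=
  forall q, q < n -> pos q \in K ->
    nth unknown al q = (nth false a q, ~~ nth false a q).

Lemma covers_cat K1 K2 al : covers (K1 ++ K2) al -> covers K1 al /\ covers K2 al.
Proof. by move=> h; split=> q lq qK; apply: h; rewrite // mem_cat qK ?orbT. Qed.

Definition bvals := node_values false eval_gate a.
Definition kvals al := node_values unknown cell_step al.
Definition depths :=
  node_values 0 (fun _ ds => (\max_(d <- ds) d).+1) (nseq n 0).
Definition wefts :=
  node_values 0 (fun g ws => (2 < size (preds g)) + \max_(w <- ws) w) (nseq n 0).

(** Quantifying over all sound [al] makes the certificate robust: any further correct information
    leaves the value of the node as it is. *)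
Definition known_by gs i K :=
  forall al, sound al -> covers K al ->
    nth unknown (kvals al gs) i = (nth false (bvals gs) i, ~~ nth false (bvals gs) i).

Lemma known_by_seq gs ps m :
  (forall p, p \in ps -> exists2 K, size K <= m & known_by gs p K) ->
  exists2 K, size K <= size ps * m &
    forall p, p \in ps -> known_by gs p K.
Proof.
elim: ps => [|p ps IH] h; first by exists [::].
have [|K2 s2 k2] := IH; first by move=> q qp; apply: h; rewrite inE qp orbT.
have [K1 s1 k1] := h p (mem_head _ _).
exists (K1 ++ K2); first by rewrite size_cat mulSn leq_add.
move=> q; rewrite inE => /predU1P [->|qp] al sal /covers_cat [c1 c2].
  exact: k1.
exact: k2.
Qed.

Lemma leq_bigmax_seq_map (f : nat -> nat) ps p :
  p \in ps -> f p <= \max_(x <- [seq f i | i <- ps]) x.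
Proof. by move=> h; rewrite big_map; apply: leq_bigmax_seq. Qed.

(** Below a large gate the weft is 0, where no default is ever used, so the partial values there are
    sound. This is the first claim, and the second needs it to handle a large gate. *)
Lemma kleene_values gs i :
  (forall u g v, gs = u ++ g :: v -> wf_gate (n + size u) g) ->
  i < n + size gs ->
  (nth 0 (wefts gs) i = 0 -> forall al, sound al ->
     agrees (nth unknown (kvals al gs) i) (nth false (bvals gs) i)) /\
  (nth 0 (wefts gs) i <= 1 ->
     exists2 K, size K <= 2 ^ nth 0 (depths gs) i & known_by gs i K).
Proof.
elim/last_ind: gs i => [|gs g IH] i wf.
  rewrite addn0 /wefts /kvals /bvals /depths /known_by /node_values /= => li.
  split=> [_ al [_ h] | _]; first exact: h.
  (* An input has depth 0 and is known as soon as its own block is: [2 ^ 0] blocks. *)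
  exists [:: pos i]; first by rewrite nth_nseq li.
  by move=> al _ cv; apply: cv; rewrite ?mem_head.
have {}IH j lj := IH j (fun u g' v (e : gs = u ++ g' :: v) => wf u g' (rcons v g)
    ltac:(by rewrite e rcons_cat)) lj.
have sb : size (bvals gs) = n + size gs by rewrite size_node_values sa.
have sd : size (depths gs) = n + size gs by rewrite size_node_values size_nseq.
have sw : size (wefts gs) = n + size gs by rewrite size_node_values size_nseq.
have sk al : sound al -> size (kvals al gs) = n + size gs.
  by case=> e _; rewrite size_node_values e.
rewrite size_rcons addnS ltnS leq_eqVlt => /predU1P [->|li]; last first.
  have [IH1 IH2] := IH i li.
  rewrite /wefts /bvals /depths !node_values_rcons -/(wefts _) -/(bvals _) -/(depths _).
  rewrite !nth_rcons sw sb sd li; split=> [w0 al sal|w1].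
    by rewrite /kvals node_values_rcons -/(kvals _ _) nth_rcons sk // li; apply: IH1.
  have [K sK hK] := IH2 w1; exists K => // al sal cv.
  rewrite /kvals node_values_rcons -/(kvals _ _) nth_rcons sk // li.
  by rewrite /bvals node_values_rcons -/(bvals _) nth_rcons sb li; apply: hK.
rewrite /wefts /bvals /depths !node_values_rcons -/(wefts _) -/(bvals _) -/(depths _).
rewrite !nth_rcons sw sb sd ltnn eqxx.
set ps := preds g.
have /and3P [ups al_ps kd] : wf_gate (n + size gs) g.
  by apply: (wf gs g [::]); rewrite cats1.
have IHp p : p \in ps -> _ := fun h => IH p (allP al_ps p h).
pose bp p := nth false (bvals gs) p (+) negates_inputs (kind g).
have evE : eval_gate g [seq nth false (bvals gs) i | i <- ps] =
   all id (map bp ps) (+) negates_output (kind g).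
  rewrite eval_gateE -?map_comp // => e; rewrite size_map.
  by move: kd; rewrite e => /eqP.
have kE al : sound al -> nth unknown (kvals al (rcons gs g)) (n + size gs) =
   swap_if (negates_output (kind g)) (conj_cells [seq swap_if (negates_inputs (kind
     g)) (nth unknown (kvals al gs) p) | p <- ps]).
  move=> sal; rewrite /kvals node_values_rcons -/(kvals _ _) nth_rcons sk // ltnn eqxx.
  by rewrite /cell_step -map_comp.
have lw p : p \in ps -> nth 0 (wefts gs) p <= \max_(w <- [seq nth 0 (wefts gs) i | i
  <- ps]) w.
  exact: leq_bigmax_seq_map.
have ld p : p \in ps -> nth 0 (depths gs) p <= \max_(w <- [seq nth 0 (depths gs) i |
  i <- ps]) w.
  exact: leq_bigmax_seq_map.
set mw := \max_(w <- _) w in lw *; set md := \max_(w <- _) w in ld *.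
have okp al : sound al -> mw = 0 ->
  {in ps, forall p, agrees (swap_if (negates_inputs (kind g)) (nth unknown (kvals al
    gs) p)) (bp p)}.
  move=> sal w0 p pp; rewrite agrees_swap; apply: (proj1 (IHp p pp)) => //.
  by have := lw p pp; rewrite w0 leqn0 => /eqP.
split=> [/eqP|].
  rewrite addn_eq0 eqb0 -leqNgt => /andP [small /eqP w0] al sal.
  rewrite kE // evE agrees_swap; apply: conj_cells_sound small => //.
  exact: okp.
(* A large gate uses up the whole weft, hence its predecessors have weft 0. *)
case: (ltnP 2 (size ps)) => [large|small].
  rewrite add1n ltnS leqn0 => /eqP w0.
  case eall: (all id (map bp ps)).
    exists [::] => // al sal _.
    rewrite kE // /bvals node_values_rcons -/(bvals _) nth_rcons sb ltnn eqxx evE.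
    rewrite (conj_cells_large_true (okp al sal w0) large eall) eall.
    exact: (known_swap _ true).
  (* A single predecessor that falsifies the conjunction settles the gate, so its certificate is
     enough. *)
  have /allPn [b] := negbT eall; case/mapP => p pp -> nb.
  have [|K sK hK] := proj2 (IHp p pp); first by rewrite (leq_trans (lw p pp)) // w0.
  exists K.
    by rewrite (leq_trans sK) // leq_exp2l // ltnW // ltnS ld.
  move=> al sal cv.
  rewrite kE // /bvals node_values_rcons -/(bvals _) nth_rcons sb ltnn eqxx evE.
  rewrite (conj_cells_large_false (i := p) large pp) ?eall;
    first exact: (known_swap _ false).
  by rewrite hK // known_swap -/(bp p) (negbTE nb).
rewrite add0n => w1.
(* A small gate takes the certificates of its at most two predecessors together; the factor 2 is
   paid for by the extra level of depth. *)
have [|K sK hK] := @known_by_seq gs ps (2 ^ md).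
  move=> p pp; have [|K sK hK] := proj2 (IHp p pp).
    exact: leq_trans (lw p pp) w1.
  by exists K => //; rewrite (leq_trans sK) // leq_exp2l // ld.
exists K.
  by rewrite (leq_trans sK) // expnS leq_mul2r small orbT.
move=> al sal cv.
rewrite kE // /bvals node_values_rcons -/(bvals _) nth_rcons sb ltnn eqxx evE.
rewrite (@conj_cells_known _ _ bp) //; first exact: known_swap.
by move=> p pp; rewrite hK // known_swap.
Qed.

(** Holds at any weft, even where defaults are wrong: a large gate has the form [(~~ s0, s0)], and a
    small gate in conflict would have a predecessor in conflict, down to an input. *)
Lemma no_conflict gs al :
  (forall u g v, gs = u ++ g :: v -> wf_gate (n + size u) g) ->
  sound al -> all (fun c => ~~ (c.1 && c.2)) (kvals al gs).
Proof.
move=> wf [sal ok]; elim/last_ind: gs wf => [|gs g IH] wf.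
  apply/(all_nthP unknown) => q; rewrite sal => lq.
  by have := ok q lq; rewrite /agrees; case: (nth unknown al q) (nth false a q) =>
    [[] []] [].
rewrite /kvals node_values_rcons -/(kvals al gs) all_rcons.
have {}IH : all (fun c => ~~ (c.1 && c.2)) (kvals al gs).
  by apply: IH => u g' v e; apply: (wf u g' (rcons v g)); rewrite e rcons_cat.
rewrite IH andbT; have /and3P [_ /allP ps _] : wf_gate (n + size gs) g.
  by apply: (wf gs g [::]); rewrite cats1.
have sws s c : ~~ ((swap_if s c).1 && (swap_if s c).2) = ~~ (c.1 && c.2).
  by case: s c => [] [[] []].
rewrite /cell_step sws -map_comp /conj_cells size_map /=; case: ifP => _.
  by case: has.
apply/negP => /andP [/allP h1 /hasP [c /mapP [p pp ->]]] /=.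
have := h1 _ (map_f _ pp) => /= h2 h3.
have := allP IH (nth unknown (kvals al gs) p).
rewrite mem_nth ?size_node_values ?sal ?ps // => /(_ isT).
by rewrite -(sws (negates_inputs (kind g))) h2 h3.
Qed.

End Kleene.

(** * Segments between consecutive true inputs *)

(* The segment [(a, b)] asserts that the inputs [a .. b - 2] are false and that
   [b - 1] is true. *)
Definition says1 q (p : nat * nat) := (p.1 <= q) && (p.2 == q.+1).
Definition says0 q (p : nat * nat) := (p.1 <= q) && (q.+1 < p.2).

Lemma nth_paints w cs q : q < size cs ->
  nth unknown (paints w cs) q =
  ((nth unknown cs q).1 || has (says1 q) w, (nth unknown cs q).2 || has (says0 q) w).
Proof.
elim: w cs => [|p w IH] cs lq /=; first by rewrite !orbF; case: (nth _ _ _).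
rewrite IH ?size_paint // nth_paint //; case: (nth unknown cs q) => c1 c0 /=.
rewrite /paint1 /= /says1 /says0 -/(says1 q) -/(says0 q) -subn_eq0.
case: (p.1 - q) => [|d] //=.
have -> : (p.2 == q.+1) = (p.2 - q == 1).
  by apply/eqP/eqP; lia.
have -> : (q.+1 < p.2) = (1 < p.2 - q) by apply/idP/idP; lia.
by case: (p.2 - q) => [|[|e]] //=; case: c1; case: c0; rewrite ?orbT ?orbF.
Qed.

Lemma nth_node_values (A : Type) (a0 : A) st ins gs q : q < size ins ->
  nth a0 (node_values a0 st ins gs) q = nth a0 ins q.
Proof.
elim/last_ind: gs => [|gs g IH] // lq; rewrite node_values_rcons nth_rcons.
by rewrite size_node_values ltn_addr // IH.
Qed.

Section Segments.
Variables (n k : nat) (t : nat -> nat).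

(** A bound [b] stands for the true input [b - 1]. This shift lets the bounds increase strictly from
    0 even if input 0 is true; [n.+1] stands for the dummy input [n]. *)
Definition valid_bounds : Prop :=
  [/\ t 0 = 0, t k.+1 = n.+1 & forall i, i <= k -> t i < t i.+1].

Definition marked : seq bool := mkseq (fun q => q.+1 \in map t (iota 1 k)) n.

Definition segment_of q := find (fun i => q < t i.+1) (iota 0 k.+1).

Hypothesis vt : valid_bounds.

Lemma bounds_mono i j : i <= j -> j <= k.+1 -> t i <= t j.
Proof.
case: vt => _ _ inc; elim: j => [|j IH] lij lj; first by move: lij; rewrite leqn0 =>
  /eqP ->.
move: lij; rewrite leq_eqVlt => /predU1P [->//|lij].
by apply: leq_trans (IH _ _) (ltnW (inc _ _)); rewrite // ltnW.
Qed.

Lemma bounds_smono i j : i < j -> j <= k.+1 -> t i < t j.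
Proof.
move=> lij lj; case: vt => _ _ inc.
by apply: leq_trans (bounds_mono lij lj); apply: inc; rewrite -ltnS (leq_trans lij).
Qed.

Lemma bounds_le i : i <= k.+1 -> t i <= n.+1.
Proof. by case: (vt) => _ <- _ li; apply: bounds_mono. Qed.

Lemma segment_ofP q : q <= n ->
  [/\ segment_of q <= k, t (segment_of q) <= q & q < t (segment_of q).+1].
Proof.
case: (vt) => t0 tk inc lq.
have h : has (fun i => q < t i.+1) (iota 0 k.+1).
  by apply/hasP; exists k; rewrite ?mem_iota ?add0n ?ltnSn //= tk ltnS.
have lk : segment_of q < k.+1 by rewrite /segment_of -[X in _ < X](size_iota 0 k.+1)
  -has_find.
have := nth_find 0 h; rewrite -/(segment_of q) nth_iota // add0n => lt.
split=> //; case e: (segment_of q) => [|j]; first by rewrite t0.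
have lj : j < find (fun i => q < t i.+1) (iota 0 k.+1) by rewrite -/(segment_of q) e.
have := before_find 0 lj; rewrite nth_iota ?add0n; last by rewrite -ltnS -e ltnW.
by move/negbT; rewrite -leqNgt.
Qed.

Lemma segment_of_uniq q i : q <= n -> i <= k -> t i <= q -> q < t i.+1 ->
  segment_of q = i.
Proof.
move=> lq li l1 l2; have [lk l3 l4] := segment_ofP lq.
case: (ltngtP (segment_of q) i) => // [lt|gt].
  by have := bounds_mono lt (leqW li); lia.
by have := bounds_mono gt (leqW lk); lia.
Qed.

Lemma size_marked : size marked = n. Proof. exact: size_mkseq. Qed.

Lemma nth_marked q : q < n -> nth false marked q = (t (segment_of q).+1 == q.+1).
Proof.
move=> lq; rewrite nth_mkseq //; have [lk l3 l4] := segment_ofP (ltnW lq).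
apply/mapP/eqP => [[i]|e].
  rewrite mem_iota add1n ltnS => /andP [i0 ik] e.
  case: i i0 ik e => // i _ ik e.
  suff -> : segment_of q = i by [].
  apply: segment_of_uniq; [exact: ltnW | exact: ltnW | | by rewrite -e].
  by rewrite -ltnS e; case: vt => _ _; apply; apply: ltnW.
exists (segment_of q).+1; rewrite // mem_iota add1n /= ltnS.
(* Segment [k] ends in the dummy input, which is not below [n]. *)
rewrite ltn_neqAle lk andbT; apply/eqP => ek.
by case: vt => _ tk _; move: e; rewrite ek tk => -[] e; rewrite e ltnn in lq.
Qed.

(** The true inputs are the predecessors of the [k] inner bounds, which are distinct by strict
    monotonicity. *)
Lemma count_marked : count id marked = k.
Proof.
rewrite /marked /mkseq count_map -size_filter.
apply: (@etrans _ _ (size [seq (t i).-1 | i <- iota 1 k]));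
  last by rewrite size_map size_iota.
apply/perm_size; apply: uniq_perm.
- by rewrite filter_uniq // iota_uniq.
- rewrite map_inj_in_uniq ?iota_uniq // => i j.
  rewrite !mem_iota !add1n !ltnS => /andP [i0 ik] /andP [j0 jk].
  have ti : 0 < t i by case: vt => <- _ _; apply: bounds_smono; rewrite // ltnW.
  have tj : 0 < t j by case: vt => <- _ _; apply: bounds_smono; rewrite // ltnW.
  move=> e; case: (ltngtP i j) => // lt.
    by have := bounds_smono lt (leqW jk); lia.
  by have := bounds_smono lt (leqW ik); lia.
move=> q; rewrite mem_filter mem_iota add0n /=; apply/andP/mapP.
  case=> /mapP [i ii e] lq; exists i => //.
  by rewrite -e.
case=> i; rewrite mem_iota add1n ltnS => /andP [i0 ik] e.
have ti : 0 < t i by case: vt => <- _ _; apply: bounds_smono; rewrite // ltnW.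
have e' : q.+1 = t i by lia.
split; first by apply/mapP; exists i => //; rewrite mem_iota add1n ltnS i0.
by rewrite -ltnS e'; case: (vt) => _ <- _; apply: bounds_smono; rewrite // ltnS.
Qed.

Lemma segment_sound i q : i <= k -> q < n ->
  (says1 q (t i, t i.+1) -> nth false marked q) /\
  (says0 q (t i, t i.+1) -> ~~ nth false marked q).
Proof.
move=> li lq; rewrite nth_marked //; split=> /andP [/= l1 l2].
  by rewrite (segment_of_uniq (ltnW lq) li l1) // (eqP l2).
rewrite (segment_of_uniq (ltnW lq) li l1) ?(ltnW l2) //.
by apply/eqP => e; rewrite e ltnn in l2.
Qed.

Lemma segment_complete q : q < n ->
  let p := (t (segment_of q), t (segment_of q).+1) in
  (nth false marked q -> says1 q p) /\ (~~ nth false marked q -> says0 q p).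
Proof.
move=> lq; rewrite nth_marked //= /says1 /says0 /=.
have [lk -> l4] := segment_ofP (ltnW lq).
by split=> // ne; rewrite ltn_neqAle eq_sym ne.
Qed.

End Segments.

Lemma valid_of_assignment n (a : seq bool) : size a = n ->
  exists2 t, valid_bounds n (count id a) t & a = marked n (count id a) t.
Proof.
move=> sa; pose ones := [seq q.+1 | q <- iota 0 n & nth false a q].
have so : size ones = count id a.
  rewrite size_map size_filter -{2}(mkseq_nth false a) sa /mkseq count_map.
  by apply: eq_count.
pose s := 0 :: rcons ones n.+1.
have srt : sorted ltn s.
  rewrite /s /= rcons_path; apply/andP; split.
    rewrite path_sortedE; last exact: ltn_trans.
    apply/andP; split; first by apply/allP => x /mapP [q _ ->].
    apply: (homo_sorted (e := ltn)); first by move=> x y.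
    by apply: sorted_filter; [exact: ltn_trans | exact: iota_ltn_sorted].
  have : last 0 ones \in 0 :: ones by apply: mem_last.
  rewrite inE => /predU1P [->//|/mapP [q]].
  by rewrite mem_filter mem_iota add0n => /andP [_ lq] ->; apply: lq.
have ss : size s = (count id a).+2 by rewrite /= size_rcons so.
have vt : valid_bounds n (count id a) (nth 0 s).
  split=> //; first by rewrite /= nth_rcons so ltnn eqxx.
  move=> i li; apply: (sorted_ltn_nth ltn_trans) => //; rewrite inE ss ltnS //.
  exact: leqW.
exists (nth 0 s) => //.
apply: (@eq_from_nth _ false); first by rewrite size_marked.
move=> q; rewrite sa => lq; rewrite nth_mkseq //.
have -> : map (nth 0 s) (iota 1 (count id a)) = ones.
  rewrite -so -{2}(take_size ones) -{2}(drop0 ones).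
  apply: (@eq_from_nth _ 0); rewrite !size_map ?size_iota.
    by rewrite drop0 take_size size_map.
  move=> i li; rewrite (nth_map 0) ?size_iota // nth_iota // add1n /=.
  by rewrite nth_rcons size_map li drop0 take_size.
rewrite mem_map; last by move=> x y [].
by rewrite mem_filter mem_iota /= lq andbT.
Qed.

(** * Equivalence of the circuit and the CSP instance *)

Lemma mem_iter_extend j L w0 w :
  reflect (exists ls, [/\ size ls = j, {subset ls <= L} & w = ls ++ w0])
    (w \in iter j (extend L) [:: w0]).
Proof.
elim: j w => [|j IH] w /=.
  rewrite inE; apply: (iffP eqP) => [->|[ls [/eqP]]]; first by exists [::].
  by rewrite size_eq0 => /eqP ->.
rewrite mem_rev; apply: (iffP allpairsP) => [[[w' l] [/= /IH [ls [sl Ls ->]] Ll ->]]|].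
  exists (l :: ls); split; rewrite //= ?sl // => x.
  by rewrite inE => /predU1P [->//|/Ls].
case=> [[|l ls]] [//= [sl] Ls ->]; exists (ls ++ w0, l); split=> //=.
  by apply/IH; exists ls; split=> // x xl; apply: Ls; rewrite inE xl orbT.
by apply: Ls; rewrite mem_head.
Qed.

Lemma uniq_extend L T : uniq L -> uniq T -> uniq (extend L T).
Proof.
by move=> uL uT; rewrite rev_uniq; apply: allpairs_uniq => // -[w l] [w' l']
  _ _ [-> ->].
Qed.

Lemma uniq_iter_extend j L T : uniq L -> uniq T -> uniq (iter j (extend L) T).
Proof. by move=> uL uT; elim: j => //= j; apply: uniq_extend. Qed.

Lemma mem_segments nn a b : ((a, b) \in segments nn) = (a < b <= nn).
Proof.
apply/allpairsPdep/idP => [[b' [a' [/=]]]|/andP [l1 l2]].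
  rewrite !mem_iota add1n add0n => h1 h2 [-> ->]; lia.
by exists b, a; rewrite !mem_iota add1n add0n; split=> //; lia.
Qed.

Lemma uniq_segments nn : uniq (segments nn).
Proof.
apply: allpairs_uniq_dep; [exact: iota_uniq | by move=> b _; exact: iota_uniq |].
by move=> [b a] [b' a'] _ _ /= [-> ->].
Qed.

Lemma mem_steps k p : (p \in steps k) = (p.1 <= k) && (p.2 == p.1.+1).
Proof.
apply/mapP/andP => [[i]|[l /eqP e]].
  by rewrite mem_iota => li -> /=; split; lia.
by exists p.1; rewrite ?mem_iota -?e; [lia | case: (p)].
Qed.

Lemma uniq_steps k : uniq (steps k).
Proof. by rewrite map_inj_uniq ?iota_uniq // => i j [->]. Qed.

Definition map_word (A : nat -> nat) (w : seq (nat * nat)) :=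
  [seq (A p.1, A p.2) | p <- w].

Lemma map_unpair A w : map A (unpair w) = unpair (map_word A w).
Proof. by elim: w => //= p w ->. Qed.

Lemma unpair_inj : injective unpair.
Proof.
elim=> [|[x y] w IH] [|[x' y'] w'] //= [-> ->] e.
by rewrite (IH w').
Qed.

Lemma wf_gates C : wf_circuit C ->
  forall u g v, gates C = u ++ g :: v -> wf_gate (inputs C + size u) g.
Proof.
case=> _ wg u g v e; have := wg (size u); rewrite e size_cat /= nth_cat ltnn subnn /=.
by apply; lia.
Qed.

Lemma word_badness0 C w : (word_badness C w == 0) =
  all (fun c => ~~ (c.1 && c.2)) (circuit_cells C w) &&
  (nth unknown (circuit_cells C w) (output C)).1.
Proof.
rewrite /word_badness /badness addn_eq0 eqb0 negbK -leqn0 leqNgt -has_count -all_predC.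
by congr (_ && _).
Qed.

(** A certificate may be short or contain numbers that are not indices of segments. Filling up with
    segment 0 gives exactly [D] genuine indices, and revealing more does no harm. *)
Definition pad D k K := take D ([seq if i <= k then i else 0 | i <- K] ++ nseq D 0).

Lemma size_pad D k K : size (pad D k K) = D.
Proof. by rewrite size_takel // size_cat size_nseq leq_addl. Qed.

Lemma pad_le D k K i : i \in pad D k K -> i <= k.
Proof.
move=> /mem_take; rewrite mem_cat => /orP [/mapP [j _ ->]|/nseqP [-> //]].
by case: ifP.
Qed.

Lemma mem_pad D k K i : size K <= D -> i <= k -> i \in K -> i \in pad D k K.
Proof.
move=> sK li iK; rewrite /pad take_cat size_map ltnNge sK /= mem_cat.
by apply/orP; left; apply/mapP; exists i; rewrite ?li.
Qed.

Definition segment t i : nat * nat := (t i, t i.+1).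

Section Word.
Variables (n k : nat) (t : nat -> nat) (w : seq (nat * nat)).
Hypothesis vt : valid_bounds n k t.
Let al := paints w (nseq n unknown).

Hypothesis facts : forall p q, p \in w -> q < n ->
  (says1 q p -> nth false (marked n k t) q) /\
  (says0 q p -> ~~ nth false (marked n k t) q).

Lemma nth_word q : q < n -> nth unknown al q = (has (says1 q) w, has (says0 q) w).
Proof. by move=> lq; rewrite nth_paints ?size_nseq // nth_nseq lq. Qed.

Lemma word_sound : sound n (marked n k t) al.
Proof.
split=> [|q lq]; first by rewrite size_paints size_nseq.
rewrite nth_word // /agrees /=; apply/andP; split; apply/implyP => /hasP [p pw h].
  by have [] := facts pw lq; auto.
by have [_] := facts pw lq; auto.
Qed.

(** The segment containing an input states its value, and soundness excludes the opposite
    statement. *)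
Lemma word_covers K : (forall i, i \in K -> i <= k -> segment t i \in w) ->
  covers n (marked n k t) (segment_of k t) K al.
Proof.
move=> cK q lq qK; have [_] := word_sound => /(_ q lq).
rewrite nth_word // /agrees /=.
have [lk _ _] := segment_ofP vt (ltnW lq).
have sw := cK _ qK lk; have [c1 c0] := segment_complete vt lq.
case: (nth false _ q) c1 c0 => /= c1 c0; rewrite ?implybT ?implybF /= => h.
  by rewrite (negbTE h); have -> : has (says1 q) w by apply/hasP;
    exists (segment t (segment_of k t q)) => //; apply: c1.
rewrite andbT in h; rewrite (negbTE h).
by have -> : has (says0 q) w by apply/hasP; exists (segment t (segment_of k t q)) =>
  //; apply: c0.
Qed.

End Word.

Section Equiv.
Variables (D k : nat) (C : circuit).
Hypotheses (D0 : 0 < D) (wfC : wf_circuit C) (w1 : weft C <= 1) (dD : 2 ^ depth C <= D).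
Let n := inputs C.

Lemma known_output a pos : size a = n ->
  exists2 K, size K <= D & known_by n a pos (gates C) (output C) K.
Proof.
move=> sa; have [lo _] := wfC.
have [_ /(_ w1) [K sK hK]] := @kleene_values n a pos sa (gates C) (output C)
  (wf_gates wfC) lo.
by exists K => //; apply: leq_trans sK dD.
Qed.

Lemma last_pair q : q < n -> says1 q (n.+1, 0) = false /\ says0 q (n.+1, 0) = false.
Proof. by move=> lq; rewrite /says1 /says0 /=; split; lia. Qed.

(** Indices may repeat in [I]; thus [nseq D i] serves to inspect the single segment [i]. *)
Lemma mem_red_csp A I : {in I, forall i, i <= k} -> size I = D ->
  (forall c, c \in constraints (red_csp D C k) -> map A (scope c) \in allowed c) ->
  let w := map_word A ([seq (i, i.+1) | i <- I] ++ guess_word k D) in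
  w \in candidates D n /\ word_badness C w = 0.
Proof.
move=> Ik sI sat w.
pose c : constraint := (unpair ([seq (i, i.+1) | i <- I]
  ++ guess_word k D), red_rel D C).
have /sat : c \in constraints (red_csp D C k).
  apply: map_f; rewrite mem_rev; apply/mem_iter_extend.
  exists [seq (i, i.+1) | i <- I]; split=> //; first by rewrite size_map.
  by move=> p /mapP [i iI ->]; rewrite mem_steps /= eqxx Ik.
rewrite /c /scope /allowed map_unpair mem_map; last exact: unpair_inj.
by rewrite mem_rev mem_filter => /andP [/eqP].
Qed.

Fixpoint guess_pairs c : seq (nat * nat) :=
  if c is c'.+1 then (k + c'.*2.+3, k + c'.*2.+2) :: guess_pairs c' else [::].

Lemma guess_wordE c : guess_word k c = rcons (guess_pairs c) (k.+1, 0).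
Proof. by elim: c => //= c ->. Qed.

Lemma size_guess_pairs c : size (guess_pairs c) = c.
Proof. by elim: c => //= c ->. Qed.

Lemma mem_guess_pairs c p : p \in guess_pairs c ->
  exists2 c', c' < c & p = (k + c'.*2.+3, k + c'.*2.+2).
Proof.
elim: c => //= c IH; rewrite inE => /predU1P [->|/IH [c' l ->]]; first by exists c.
by exists c' => //; apply: ltnW.
Qed.

(** All candidates end in the pair [(n.+1, 0)], which pins the two outer bounds; the other pairs are
    segments, so their end points increase. *)
Lemma word_in_candidates A I :
  map_word A ([seq (i, i.+1) | i <- I] ++ guess_word k D) \in candidates D n ->
  [/\ A k.+1 = n.+1, A 0 = 0 & {in I, forall i, A i < A i.+1}].
Proof.
rewrite guess_wordE -rcons_cat /map_word map_rcons => /mem_iter_extend [ls [_ Ls]].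
rewrite cats1 => /rcons_inj [els -> ->]; split=> // i iI.
have : (A i, A i.+1) \in ls.
  rewrite -els map_cat mem_cat -map_comp; apply/orP; left.
  by apply/mapP; exists i.
by move=> /Ls; rewrite mem_segments => /andP [].
Qed.

(** The values of the variables [0 .. k.+1] are read as bounds; the guessed variables are only shown
    to tell the truth about the resulting assignment. *)
Lemma csp_sound : satisfiable (red_csp D C k) ->
  exists a, [/\ size a = n, count id a = k & eval C a].
Proof.
case=> A [_ sat].
(* The constraint that inspects segment [i] in all its [D] slots forces [A i < A i.+1]; there is a
   slot because [D] is positive. *)
have vt : valid_bounds n k A.
  have h i : i <= k -> [/\ A k.+1 = n.+1, A 0 = 0 & A i < A i.+1].
    move=> li; have [||wt _] := @mem_red_csp A (nseq D i) _ _ sat.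
    - by move=> j /nseqP [-> _].
    - exact: size_nseq.
    have [-> -> hi] := word_in_candidates wt; split=> //; apply: hi.
    by rewrite mem_nseq D0 eqxx.
  by split=> [||i li]; [have [] := h 0 isT | have [] := h 0 isT | have [] := h i li].
pose a := marked n k A.
pose W I := map_word A ([seq (i, i.+1) | i <- I] ++ guess_word k D).
have segW I i : i \in I -> segment A i \in W I.
  move=> iI; rewrite /W /map_word map_cat mem_cat -map_comp; apply/orP; left.
  by apply/mapP; exists i.
(* A guess that lies about input [q] contradicts the segment containing [q], and the constraint
   inspecting that segment would find a cell [(true, true)]. *)
have zfacts p q : p \in map_word A (guess_pairs D) -> q < n ->
   (says1 q p -> nth false a q) /\ (says0 q p -> ~~ nth false a q).
  move=> pz lq; have [lk _ _] := segment_ofP vt (ltnW lq).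
  pose i := segment_of k A q.
  have [||_ /eqP] := @mem_red_csp A (nseq D i) _ _ sat.
  - by move=> j /nseqP [-> _].
  - exact: size_nseq.
  rewrite -/(W _) word_badness0 => /andP [/allP nc _].
  have := nc (nth unknown (circuit_cells C (W (nseq D i))) q).
  rewrite mem_nth; last by rewrite size_node_values size_paints size_nseq ltn_addr.
  move=> /(_ isT); rewrite nth_node_values ?size_paints ?size_nseq //.
  rewrite nth_word // /= negb_and => ncq.
  have pW : p \in W (nseq D i).
    by rewrite /W /map_word map_cat guess_wordE map_rcons mem_cat mem_rcons inE pz
      !orbT.
  have sW : segment A i \in W (nseq D i) by apply: segW; rewrite mem_nseq D0 eqxx.
  have [c1 c0] := segment_complete vt lq.
  split=> sp; case: (boolP (nth false a q)) => // na.
    case/orP: ncq => /hasPn; first by move=> /(_ p pW); rewrite sp.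
    by move=> /(_ _ sW); rewrite c0.
  case/orP: ncq => /hasPn; last by move=> /(_ p pW); rewrite sp.
  by move=> /(_ _ sW); rewrite c1.
have facts I p q : {in I, forall i, i <= k} -> p \in W I -> q < n ->
   (says1 q p -> nth false a q) /\ (says0 q p -> ~~ nth false a q).
  move=> Ik; rewrite /W /map_word map_cat mem_cat guess_wordE map_rcons mem_rcons inE.
  rewrite -map_comp => /or3P [/mapP [i iI ->]|/eqP -> |pz] lq; last exact: zfacts.
    exact: (segment_sound vt (Ik i iI)).
  have [|tk t0 _] := @word_in_candidates A (nseq D 0).
    by have [||] := @mem_red_csp A (nseq D 0) _ _ sat; [move=> j /nseqP [-> _]
      | exact: size_nseq |].
  by rewrite /= tk t0; have [-> ->] := last_pair lq.
have sa : size a = n by apply: size_marked.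
exists a; split=> //; first exact: count_marked.
(* Among the constraints is one that inspects the segments in [K]. Its evaluation of the output is
   exact, and the relation says that it is true. *)
have [K sK hK] := known_output (segment_of k A) sa.
pose I := pad D k K.
have Ik : {in I, forall i, i <= k} by move=> i; apply: pad_le.
have [||_ /eqP] := @mem_red_csp A I _ _ sat => //; first exact: size_pad.
rewrite -/(W _) word_badness0 => /andP [_].
have := hK (paints (W I) (nseq n unknown)).
rewrite /kvals -/(circuit_cells C (W I)) => ->.
- by rewrite /= /bvals /eval /output_value.
- by apply: word_sound => p q; apply: facts.
apply: word_covers => //; first by move=> p q; apply: facts.
by move=> i iK li; apply: segW; apply: mem_pad.
Qed.

(** The guess is the certificate [K] itself. Whatever a constraint inspects in addition is correct
    information, so each evaluation is exact and free of contradictions. *)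
Lemma csp_complete a : size a = n -> count id a = k -> eval C a ->
  satisfiable (red_csp D C k).
Proof.
move=> sa ca ea; have [t] := valid_of_assignment sa; rewrite ca => vt ema.
have [K sK hK] := known_output (segment_of k t) sa.
pose f l := nth 0 (pad D k K) l.
have fk l : f l <= k.
  have [ll|ge] := ltnP l D; first by apply: (@pad_le D k K); rewrite mem_nth ?size_pad.
  by rewrite /f nth_default // size_pad.
(* Beyond the bounds, the variables [k + c.*2.+3] and [k + c.*2.+2] hold the left and right end
   points of the guessed segment number [c]. *)
pose A v := if v <= k.+1 then t v else
   let u := v - k.+2 in if odd u then t (f u./2) else t (f u./2).+1.
have At v : v <= k.+1 -> A v = t v by rewrite /A => ->.
have Az c : (A (k + c.*2.+3), A (k + c.*2.+2)) = segment t (f c).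
  have e1 : (k + c.*2.+3 <= k.+1) = false by apply/negbTE; clear; lia.
  have e2 : (k + c.*2.+2 <= k.+1) = false by apply/negbTE; clear; lia.
  rewrite /A e1 e2.
  have -> : k + c.*2.+3 - k.+2 = c.*2.+1 by clear; lia.
  have -> : k + c.*2.+2 - k.+2 = c.*2 by clear; lia.
  by rewrite /= odd_double /= uphalf_double doubleK.
exists A; split=> [v _|e].
  have le i : i <= k.+1 -> t i < n.+2 by move=> li; rewrite ltnS (bounds_le vt).
  rewrite /A; case: ifP => [/le //|_]; case: odd; apply: le;
    [exact: leqW (fk _) | exact: fk].
case/mapP => w; rewrite mem_rev => /mem_iter_extend [ls [sl Ls ->]] ->.
rewrite /scope /allowed map_unpair mem_map; last exact: unpair_inj.
have wE : map_word A (ls ++ guess_word k D) =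
   ([seq segment t p.1 | p <- ls] ++ map_word A (guess_pairs D)) ++ [:: (n.+1, 0)].
  rewrite guess_wordE -cats1 /map_word !map_cat -catA; congr (_ ++ (_ ++ _)).
    apply/eq_in_map => p /Ls; rewrite mem_steps => /andP [l /eqP ->].
    by rewrite (At _ (leqW l)) (At p.1.+1).
  by rewrite /= !At //; case: vt => -> ->.
have inseg p : p \in [seq segment t p.1 | p <- ls] ++ map_word A (guess_pairs D) ->
    exists2 i, i <= k & p = segment t i.
  rewrite mem_cat => /orP [/mapP [p' /Ls] | /mapP [p' /mem_guess_pairs [j lj ->] ->]].
    by rewrite mem_steps => /andP [l _] ->; exists p'.1.
  by rewrite Az; exists (f j).
rewrite mem_rev mem_filter; apply/andP; split; last first.
  apply/mem_iter_extend; eexists; split; last exact: wE.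
    by rewrite size_cat !size_map sl size_guess_pairs addnn.
  move=> p /inseg [i li ->]; rewrite mem_segments.
  case: (vt) => _ _ -> //=; exact: (bounds_le vt).
have facts p q : p \in map_word A (ls ++ guess_word k D) -> q < n ->
   (says1 q p -> nth false (marked n k t) q) /\ (says0 q p ->
     ~~ nth false (marked n k t) q).
  rewrite wE mem_cat => /orP [/inseg [i li ->]|].
    exact: segment_sound.
  by rewrite inE => /eqP -> lq; have [-> ->] := last_pair lq.
have snd := word_sound facts.
rewrite word_badness0; apply/andP; split.
  by apply: (@no_conflict n (marked n k t)) => //; apply: wf_gates.
rewrite /circuit_cells -/(kvals _ _) hK /=.
- by move: ea; rewrite /eval /output_value.
- by rewrite ema.
rewrite ema; apply: word_covers => // i iK li.
rewrite wE mem_cat mem_cat; apply/orP; left; apply/orP; right.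
have ip := mem_pad sK li iK.
have lc : index i (pad D k K) < D by rewrite -[X in _ < X](size_pad D k K) index_mem.
have fi : f (index i (pad D k K)) = i by rewrite /f nth_index.
rewrite -fi -Az; set c := index _ _ in lc *.
suff h : (k + c.*2.+3, k + c.*2.+2) \in guess_pairs D by apply: (map_f _ h).
elim: (D) lc => //= j IH; rewrite ltnS leq_eqVlt inE => /predU1P [->|/IH ->].
  by rewrite eqxx.
by rewrite orbT.
Qed.

End Equiv.

(** * Well-formedness of the constructed instance *)

Section Instance.
Variables (D k : nat) (C : circuit).

Lemma all_unpair (P : pred nat) w : all P (unpair w) = all (fun p => P p.1 && P p.2) w.
Proof. by elim: w => //= p w ->; rewrite andbA. Qed.

Lemma guess_word_bound c p : p \in guess_word k c ->
  p.1 < k + c.*2.+2 /\ p.2 < k + c.*2.+2.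
Proof.
rewrite guess_wordE mem_rcons inE => /predU1P [->|/mem_guess_pairs [c' lc ->]] /=;
  split; lia.
Qed.

Lemma scope_bound w p : w \in scopes D k -> p \in w ->
  p.1 < red_vars D k /\ p.2 < red_vars D k.
Proof.
move=> /mem_iter_extend [ls [_ Ls ->]]; rewrite mem_cat /red_vars =>
  /orP [/Ls|/guess_word_bound //].
by rewrite mem_steps => /andP [l /eqP ->]; split; lia.
Qed.

Lemma candidate_bound w p : w \in candidates D (inputs C) -> p \in w ->
  p.1 < (inputs C).+2 /\ p.2 < (inputs C).+2.
Proof.
move=> /mem_iter_extend [ls [_ Ls ->]]; rewrite mem_cat => /orP [/Ls|].
  by case: p => a b; rewrite mem_segments => /andP [l1 l2] /=; split; lia.
by rewrite inE => /eqP -> /=; split; lia.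
Qed.

Lemma size_scope w : w \in scopes D k -> size w = D.*2.+1.
Proof.
move=> /mem_iter_extend [ls [sl _ ->]].
by rewrite size_cat sl guess_wordE size_rcons size_guess_pairs addnS addnn.
Qed.

Lemma size_candidate w : w \in candidates D (inputs C) -> size w = D.*2.+1.
Proof. by move=> /mem_iter_extend [ls [sl _ ->]]; rewrite size_cat sl addn1. Qed.

Lemma red_wf_csp : wf_csp (red_csp D C k).
Proof.
split.
  apply/allP => c cin; have [w] := mapP cin; rewrite mem_rev => ws {cin}->;
    apply/and3P; split=> /=.
  - rewrite all_unpair; apply/allP => p pw; by have [-> ->] := scope_bound ws pw.
  - rewrite /red_rel map_inj_uniq; last exact: unpair_inj.
    by rewrite rev_uniq filter_uniq // uniq_iter_extend // uniq_segments.
  - apply/allP => r rin; have [v] := mapP rin.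
    rewrite mem_rev mem_filter => /andP [_ vt] {rin}->.
    rewrite !size_unpair (size_scope ws) (size_candidate vt) eqxx /= all_unpair.
    by apply/allP => p pv; have [-> ->] := candidate_bound vt pv.
(* All relations are equal, so the constraints have to be distinguished by their scopes, which come
   from distinct words. *)
rewrite /Defs.ncons size_map => i j li lj.
rewrite /constr /scope !(nth_map [::]) //= => /unpair_inj e _.
apply/eqP; rewrite -(nth_uniq [::] li lj) ?e //.
by rewrite rev_uniq uniq_iter_extend // uniq_steps.
Qed.

Lemma red_ncons : Defs.ncons (red_csp D C k) = size (scopes D k).
Proof. by rewrite /Defs.ncons size_map size_rev. Qed.

Lemma red_wf_bigraph :
  wf_bigraph (Defs.ncons (red_csp D C k)) (nvars (red_csp D C k)) (red_nb D k).
Proof.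
rewrite /wf_bigraph red_ncons size_nseq eqxx /=; apply/allP => s /nseqP [-> _].
by rewrite iota_uniq; apply/allP => v; rewrite mem_iota.
Qed.

Lemma red_complete i v :
  @bigraph_of (Defs.ncons (red_csp D C k)) (nvars (red_csp D C k)) (red_nb D k) i v.
Proof.
by rewrite /bigraph_of nth_nseq -red_ncons ltn_ord mem_iota /=.
Qed.

Lemma red_interval (R : realType) : interval_bigraph R
  (@bigraph_of (Defs.ncons (red_csp D C k)) (nvars (red_csp D C k)) (red_nb D k)).
Proof.
exists (fun _ => `]-oo, +oo[%R), (fun _ => `]-oo, +oo[%R) => i v.
rewrite red_complete; split=> // _; exists 0%R.
by rewrite in_itv.
Qed.

Lemma red_adds : adds_at_most (red_vars D k) (@incidence (red_csp D C k))
  (@bigraph_of (Defs.ncons (red_csp D C k)) (nvars (red_csp D C k)) (red_nb D k)).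
Proof.
split=> [i v _|i]; first exact: red_complete.
by apply: leq_trans (max_card _) _; rewrite card_ord.
Qed.

End Instance.

(** * Computable functions and composition of reductions *)

(** A loop contributes one factor [N.+1], so coefficient and exponent depend on the program only. *)
Lemma max_time_poly p : exists c e, forall N, max_time N p <= c * N.+1 ^ e.
Proof.
elim: p => [|r b|p [c1 [e1 h1]] q [c2 [e2 h2]]|
  r p [c1 [e1 h1]] q [c2 [e2 h2]] q' [c3 [e3 h3]]|r p [c [e h]]].
- by exists 1, 0 => N.
- by exists 1, 0 => N.
- exists (c1 + c2), (e1 + e2) => N /=; rewrite mulnDl leq_add //.
    by apply: leq_trans (h1 N) _; rewrite leq_mul2l leq_pexp2l ?leq_addr ?orbT.
  by apply: leq_trans (h2 N) _; rewrite leq_mul2l leq_pexp2l ?leq_addl ?orbT.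
- exists (c1 + c2 + c3).+1, (e1 + e2 + e3) => N /=; rewrite mulSn !mulnDl -add1n.
  rewrite leq_add // ?expn_gt0 //; rewrite !leq_add //.
  + by apply: leq_trans (h1 N) _; rewrite leq_mul2l leq_pexp2l ?orbT //; lia.
  + by apply: leq_trans (h2 N) _; rewrite leq_mul2l leq_pexp2l ?orbT //; lia.
  + by apply: leq_trans (h3 N) _; rewrite leq_mul2l leq_pexp2l ?orbT //; lia.
exists c.+2, e.+1 => N /=; have := h N; rewrite expnS.
have : 0 < N.+1 ^ e by rewrite expn_gt0.
move: (N.+1 ^ e) (max_time N p) => X T X0 le; nia.
Qed.

(** A step pushes at most one symbol; hence running time bounds the size of intermediate outputs. *)
Lemma exec_size p s t s' r : exec p s t s' -> size (s' r) <= size (s r) + t.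
Proof.
elim=> {p s t s'} [s|r' b s|p q s1 s2 s3 t u _ h1 _ h2|r' pe pt pf s t s' e _ h
  |r' pe pt pf s w t s' e _ h|r' pe pt pf s w t s' e _ h|r' p s e
  |r' p s1 s2 s3 t u ne _ h1 _ h2].
- exact: leq_addr.
- by rewrite updE; case: eqP => [->|_] /=; rewrite ?addn1 ?leq_addr.
- lia.
- lia.
- by apply: leq_trans h _; rewrite updE; case: eqP => [->|_]; rewrite ?e /=; lia.
- by apply: leq_trans h _; rewrite updE; case: eqP => [->|_]; rewrite ?e /=; lia.
- exact: leq_addr.
- lia.
Qed.

Definition glue m (s u : store) : store := fun i => if i < m then s i else u (i - m).

Lemma glueL m s u i : i < m -> glue m s u i = s i.
Proof. by rewrite /glue => ->. Qed.

Lemma glueR m s u i : glue m s u (m + i) = u i.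
Proof. by rewrite /glue ltnNge leq_addr /= addKn. Qed.

Lemma upd_glueL m s u r w : r < m -> upd (glue m s u) r w = glue m (upd s r w) u.
Proof.
move=> lr; apply: funext => i; rewrite /glue !updE.
by case: (eqVneq i r) => [->|_]; rewrite ?lr.
Qed.

Lemma upd_glueR m s u r w : upd (glue m s u) (m + r) w = glue m s (upd u r w).
Proof.
apply: funext => i; rewrite /glue !updE.
case: (ltnP i m) => [li|le]; first by case: eqP => // e; rewrite e in li; lia.
by have -> : (i == m + r) = (i - m == r) by apply/eqP/eqP; lia.
Qed.

Fixpoint shift m p : prog :=
  match p with
  | Skip => Skip
  | Push r b => Push (m + r) b
  | Seq p q => Seq (shift m p) (shift m q)
  | Case r p q q' => Case (m + r) (shift m p) (shift m q) (shift m q')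
  | While r p => While (m + r) (shift m p)
  end.

Lemma exec_shift m s p u t u' :
  exec p u t u' -> exec (shift m p) (glue m s u) t (glue m s u').
Proof.
elim=> {p u t u'} /=.
- by move=> ?; constructor.
- by move=> r b u; rewrite -upd_glueR -(glueR m s u r); constructor.
- by move=> p q u1 u2 u3 t v _ h1 _ h2; econstructor; eauto.
- by move=> r pe pt pf u t u' e _ h; apply: ExecCaseNil; rewrite ?glueR.
- move=> r pe pt pf u w t u' e _ h.
  by apply: (@ExecCaseTrue _ _ _ _ _ w); rewrite ?glueR ?upd_glueR.
- move=> r pe pt pf u w t u' e _ h.
  by apply: (@ExecCaseFalse _ _ _ _ _ w); rewrite ?glueR ?upd_glueR.
- by move=> r p u e; constructor; rewrite glueR.
- by move=> r p u1 u2 u3 t v ne _ h1 _ h2; econstructor; rewrite ?glueR; eauto.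
Qed.

Fixpoint bound p : nat :=
  match p with
  | Skip => 0
  | Push r _ => r.+1
  | Seq p q => maxn (bound p) (bound q)
  | Case r p q q' => maxn r.+1 (maxn (bound p) (maxn (bound q) (bound q')))
  | While r p => maxn r.+1 (bound p)
  end.

Lemma exec_glue m u p s t s' : bound p <= m ->
  exec p s t s' -> exec p (glue m s u) t (glue m s' u).
Proof.
move=> le h; elim: h le => {p s t s'} /=.
- by move=> ? _; constructor.
- by move=> r b s lr; rewrite -upd_glueL // -(glueL s u lr); constructor.
- move=> p q s1 s2 s3 t v _ h1 _ h2; rewrite geq_max => /andP [l1 l2].
  by econstructor; [apply: h1 | apply: h2].
- move=> r pe pt pf s t s' e _ h; rewrite !geq_max => /and4P [lr l1 l2 l3].
  by apply: ExecCaseNil; [rewrite glueL | apply: h].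
- move=> r pe pt pf s w t s' e _ h; rewrite !geq_max => /and4P [lr l1 l2 l3].
  by apply: (@ExecCaseTrue _ _ _ _ _ w); [rewrite glueL | rewrite upd_glueL //;
    apply: h].
- move=> r pe pt pf s w t s' e _ h; rewrite !geq_max => /and4P [lr l1 l2 l3].
  by apply: (@ExecCaseFalse _ _ _ _ _ w); [rewrite glueL | rewrite upd_glueL //;
    apply: h].
- by move=> r p s e; rewrite geq_max => /andP [lr _]; constructor; rewrite glueL.
- move=> r p s1 s2 s3 t v ne _ h1 _ h2; rewrite geq_max => /andP [lr lp].
  econstructor; [by rewrite glueL | exact: h1 |].
  by apply: h2; rewrite geq_max lr.
Qed.

Definition empty : store := fun _ => [::].

Lemma init_glue m x y : 1 < m -> init x y = glue m (init x y) empty.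
Proof.
move=> lm; apply: funext => i; rewrite /glue; case: ltnP => // le.
by case: i le => [|[|i]] //; lia.
Qed.

Lemma init0 x : init x [::] = upd empty 0 x.
Proof. by apply: funext => -[|[|i]]. Qed.

Lemma run_exec N p s s' : run N p s s' -> exists t, exec p s t s'.
Proof. by case=> t h _; exists t. Qed.

Lemma computable2 f g : computable f -> computable g ->
  exists p m, 2 < m /\ forall n, exists t s u,
    [/\ exec p (init (unary n) [::]) t (glue m s u),
        s 0 = unary (f n) & u 0 = unary (g n)].
Proof.
(* With at least 3 stacks in the lower part, stack [m] differs from 0, 1 and the scratch stack
   [rTMP] of [copy]. *)
case=> p hp [q hq]; pose m := maxn 3 (bound p).
have lm : 2 < m by rewrite leq_max.
exists (copy 0 m ;; p ;; shift m q), m; split=> // n.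
have [t1 [s [e1 h1]]] := hp n; have [t2 [u [e2 h2]]] := hq n.
have [|t0 e0] := @run_exec n (copy 0 m) (init (unary n) [::])
   (upd (init (unary n) [::]) m (unary n)).
  have l0 : 0 != m by rewrite eq_sym -lt0n; lia.
  apply: run_eq; first by apply: run_copy; rewrite // ?size_nseq // gtn_eqF.
  by rewrite /= (_ : init _ _ m = [::]) ?cats0 //; case: (m) lm => [|[|]].
have eI : upd (init (unary n) [::]) m (unary n) =
   glue m (init (unary n) [::]) (init (unary n) [::]).
  rewrite {1}(@init_glue m) ?(ltnW lm) // -[X in upd _ X]addn0 upd_glueR.
  by rewrite -init0.
rewrite eI in e0.
exists (t0 + (t1 + t2)), s, u; split=> //; apply: ExecSeq e0 _.
apply: ExecSeq (exec_shift m s e2).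
by apply: exec_glue e1; rewrite leq_max leqnn orbT.
Qed.

Lemma computable_add f g : computable f -> computable g ->
  computable (fun n => f n + g n).
Proof.
move=> cf cg; have [p [m [lm h]]] := computable2 cf cg.
exists (p ;; transfer m 0) => n; have [t [s [u [e es eu]]]] := h n.
have eum : glue m s u m = unary (g n) by rewrite -[X in glue _ _ _ X]addn0 glueR.
have ne : m != 0 by lia.
have le : size (glue m s u m) <= g n by rewrite eum size_nseq.
have [t' e'] := run_exec (run_transfer ne le).
exists (t + t'); eexists; split; first exact: ExecSeq e e'.
rewrite eum updE eq_sym gtn_eqF ?updE /=; last by lia.
by rewrite glueL ?es; [rewrite rev_nseq -nseqD addnC | lia].
Qed.

Lemma computable_mul f g : computable f -> computable g ->
  computable (fun n => f n * g n).
Proof.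
move=> cf cg; have [p [m [lm h]]] := computable2 cf cg.
(* Stacks 1 and 2, the accumulator and the scratch stack of [copy], may contain remains of the
   computation of [f]. *)
exists (p ;; clear 1 ;; clear 2 ;; While 0 (pop 0 ;; copy m 1) ;; transfer 1 0) => n.
have [t [s [u [e es eu]]]] := h n.
have eum : glue m s u m = unary (g n) by rewrite -[X in glue _ _ _ X]addn0 glueR.
pose N := size (s 1) + size (s 2) + f n + g n + f n * g n.
have n0 : (m == 0) = false by apply/eqP; lia.
have n1 : (m == 1) = false by apply/eqP; lia.
have n2 : (m == 2) = false by apply/eqP; lia.
pose st j := upd (upd (upd (glue m s u) 2 [::]) 0 (unary j)) 1 (unary ((f n - j) * g
  n)).
suff [t' [s' [e' h']]] : exists t' s', exec
   (clear 1 ;; clear 2 ;; While 0 (pop 0 ;; copy m 1) ;;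
     transfer 1 0) (glue m s u) t' s' /\
   s' 0 = unary (f n * g n).
  by exists (t + t'), s'; split=> //; apply: ExecSeq e e'.
have e2 : glue m s u 2 = s 2 by rewrite glueL.
have e1 : glue m s u 1 = s 1 by rewrite glueL //; lia.
have e0 : glue m s u 0 = unary (f n) by rewrite glueL //; lia.
suff [t' e'] : exists t', exec (clear 1 ;; clear 2 ;; While 0 (pop 0 ;; copy m 1) ;;
  transfer 1 0)
   (glue m s u) t' (upd (upd (st 0) 0 (unary (f n * g n))) 1 [::]).
  by exists t'; eexists; split; first exact: e'; rewrite !updE.
apply: (@run_exec N); apply: run_seq.
  by apply: run_clear; rewrite e1 /N; lia.
apply: run_seq; first by apply: run_clear; rewrite updE /= e2 /N; lia.
apply: (run_seq (s2 := st 0)).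
  have -> : upd (upd (glue m s u) 1 [::]) 2 [::] = st (f n).
    by rewrite /st subnn mul0n; upd_eq.
  apply: run_while_nat => //; first by rewrite /N; lia.
  move=> j lj; rewrite /st updE; split=> //.
  apply: run_seq (run_pop _ _ _) _; apply: run_eq.
    apply: run_copy; rewrite ?n1 ?n2 //.
    by rewrite !updE n0 n1 n2 eum size_nseq /N; lia.
  have -> : f n - j = (f n - j.+1).+1 by lia.
  by rewrite !updE n0 n1 n2 eum mulSn /unary nseqD; upd_eq.
apply: run_eq.
  apply: run_transfer; rewrite // /st updE /= size_nseq subn0 /N; lia.
by rewrite /st !updE /= rev_nseq cats0 subn0.
Qed.

Lemma computable_const c : computable (fun _ => c).
Proof.
exists (clear 0 ;; push_ones 0 c) => n.
have [|t e] := @run_exec n (clear 0 ;; push_ones 0 c) (init (unary n) [::])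
   (upd (upd (init (unary n) [::]) 0 [::]) 0 (unary c)).
  apply: run_seq; first by apply: run_clear; rewrite size_nseq.
  by apply: run_eq (run_push_ones _ _ _ _) _; rewrite updE cats0.
by exists t; eexists; split; first exact: e; rewrite updE.
Qed.

Lemma computable_exp f e : computable f -> computable (fun n => f n ^ e).
Proof.
move=> cf; elim: e => [|e IH]; first exact: computable_const.
have -> : (fun n => f n ^ e.+1) = (fun n => f n * f n ^ e).
  by apply: funext => n; rewrite expnS.
exact: computable_mul.
Qed.

Section MoveGlue.
Variables (N m : nat) (s u : store).

Lemma run_transfer_LR i j : i < m -> size (s i) <= N ->
  run N (transfer i (m + j)) (glue m s u)
    (glue m (upd s i [::]) (upd u j (rev (s i) ++ u j))).
Proof.
move=> li le; apply: run_eq.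
  by apply: run_transfer; rewrite ?glueL // neq_ltn (leq_trans li) // leq_addr.
by rewrite glueR glueL // upd_glueR upd_glueL.
Qed.

Lemma run_transfer_RL i j : j < m -> size (u i) <= N ->
  run N (transfer (m + i) j) (glue m s u)
    (glue m (upd s j (rev (u i) ++ s j)) (upd u i [::])).
Proof.
move=> lj le; apply: run_eq.
  by apply: run_transfer; rewrite ?glueR // neq_ltn (leq_trans lj) ?orbT // leq_addr.
by rewrite glueR glueL // upd_glueL // upd_glueR.
Qed.

Lemma run_transfer_RR i j : i != j -> size (u i) <= N ->
  run N (transfer (m + i) (m + j)) (glue m s u)
    (glue m s (upd (upd u j (rev (u i) ++ u j)) i [::])).
Proof.
move=> ne le; apply: run_eq; first by apply: run_transfer; rewrite ?glueR // eqn_add2l.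
by rewrite !glueR !upd_glueR.
Qed.

Lemma run_transfer_LL i j : i < m -> j < m -> i != j -> size (s i) <= N ->
  run N (transfer i j) (glue m s u)
    (glue m (upd (upd s j (rev (s i) ++ s j)) i [::]) u).
Proof.
move=> li lj ne le; apply: run_eq; first by apply: run_transfer; rewrite ?glueL.
by rewrite !glueL // !upd_glueL.
Qed.

End MoveGlue.

(** The input is transferred twice to undo the reversal; a unary parameter is its own reversal. *)
Lemma run_load N m s x k : 1 < m -> s 0 = x -> s 1 = unary k ->
  size x <= N -> k <= N ->
  run N (transfer 0 (m + 2) ;; transfer (m + 2) (m + 0) ;;
    transfer 1 (m + 1)) (glue m s empty)
    (glue m (upd (upd s 0 [::]) 1 [::]) (init x (unary k))).
Proof.
move=> lm e0 e1 lx lk; have lm0 : 0 < m by apply: ltnW.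
apply: run_seq; first by apply: run_transfer_LR; rewrite // e0.
apply: run_seq; first by apply: run_transfer_RR; rewrite // updE /= cats0 size_rev e0.
apply: run_eq; first by apply: run_transfer_LR; rewrite // updE /= e1 size_nseq.
congr glue; apply: funext => i.
rewrite e0 !updE /= e1 !cats0 revK rev_nseq.
by case: i => [|[|[|i]]].
Qed.

Lemma run_unload N m s u : 1 < m -> s 0 = [::] -> s 1 = [::] ->
  size (u 0) <= N -> size (u 1) <= N ->
  exists2 s', run N (transfer (m + 0) 1 ;; transfer 1 0 ;;
    transfer (m + 1) 1) (glue m s u) s' &
    s' 0 = u 0 /\ s' 1 = rev (u 1).
Proof.
move=> lm e0 e1 l0 l1; have lm0 : 0 < m by apply: ltnW.
eexists.
  apply: run_seq; first exact: run_transfer_RL.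
  apply: run_seq.
    by apply: run_transfer_LL; rewrite // updE /= e1 cats0 size_rev.
  by apply: run_transfer_RL; rewrite // !updE.
by rewrite !glueL // !updE /= e0 e1 !cats0 revK.
Qed.

(** The first reduction outputs an instance of fpt size, and a polynomial of an fpt bound is again
    one. *)
Lemma fpt_reducible_poly (P Q R : pproblem) (q : prog) (c e a : nat) :
  (forall x k, instance Q x k -> exists t s x' k',
     [/\ exec q (init x (unary k)) t s, s 0 = x' /\ s 1 = unary k',
         t <= c * (size x + k + 1) ^ e /\ k' <= k + a,
         instance R x' k' & positive Q x k <-> positive R x' k']) ->
  fpt_reducible P Q -> fpt_reducible P R.
Proof.
move=> hq [p [f [g [c1 [cf cg hp]]]]].
pose m := maxn 2 (bound p).
have lm : 1 < m by rewrite leq_max.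
exists (p ;; (transfer 0 (m + 2) ;; transfer (m + 2) (m + 0) ;; transfer 1 (m + 1)) ;;
  shift m q ;; (transfer (m + 0) 1 ;; transfer 1 0 ;; transfer (m + 1) 1)).
pose B n := f n + g n + 2.
(* With [M] as below and [N <= M + t2], the total is at most [M + t2 + 30 * N + 6], hence at most
   [31 * (M + t2) + 6]; the 6 is absorbed since [M] is positive. *)
exists (fun n => (37 * (c + 2)) * B n ^ e.+1), (fun n => g n + a), (c1.+1 * e.+1).
split.
- apply: computable_mul; first exact: computable_const.
  apply: computable_exp; apply: computable_add; last exact: computable_const.
  exact: computable_add.
- by apply: computable_add => //; apply: computable_const.
move=> x k ix.
have [t1 [s1 [x1 [k1 [ex1 [e0 e1] [lt1 lk1] i1 p1]]]]] := hp x k ix.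
have [t2 [s2 [x2 [k2 [ex2 [e0' e1'] [lt2 lk2] i2 p2]]]]] := hq x1 k1 i1.
have lx1 : size x1 <= size x + t1 by rewrite -e0; apply: exec_size ex1.
have lx2 : size x2 <= size x1 + t2 by rewrite -e0'; apply: exec_size ex2.
have lk2' : k2 <= k1 + t2.
  have := exec_size 1 ex2; rewrite e1' /= !size_nseq; exact.
pose N := size x1 + k1 + t2.
have lx1N : size x1 <= N by rewrite /N; lia.
have lk1N : k1 <= N by rewrite /N; lia.
have [t3 ex3 lt3] := run_load lm e0 e1 lx1N lk1N.
have [||s4 [t4 ex4 lt4] [e04 e14]] :=
  @run_unload N m (upd (upd s1 0 [::]) 1 [::]) s2 lm erefl erefl _ _.
- by rewrite e0' /N; lia.
- by rewrite e1' size_nseq /N; lia.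
exists (t1 + (t3 + (t2 + t4))), s4, x2, k2; split=> //.
- apply: ExecSeq; last apply: ExecSeq ex3 _; last apply: ExecSeq ex4.
    rewrite (@init_glue m) //; apply: exec_glue ex1.
    by rewrite leq_max leqnn orbT.
  exact: exec_shift.
- by rewrite e04 e14 e0' e1' rev_nseq.
- split; last by apply: leq_trans lk2 _; rewrite leq_add2r.
  (* Three transfers, each with at most [N] rounds of 5 steps and one final test. *)
  have {}lt3 : t3 <= N * 15 + 3 by apply: leq_trans lt3 _; rewrite /=; lia.
  have {}lt4 : t4 <= N * 15 + 3 by apply: leq_trans lt4 _; rewrite /=; lia.
  (* The exponent [c1.+1] instead of [c1] lets [Y] dominate the input size as well as the running
     time. *)
  pose X := (size x).+1; pose Y := X ^ c1.+1; pose M := B k * Y.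
  have lXY : X <= Y by rewrite /Y expnS leq_pmulr ?expn_gt0.
  have Y0 : 0 < Y by rewrite expn_gt0.
  have lt1Y : t1 <= f k * Y.
    by apply: leq_trans lt1 _; rewrite leq_mul2l leq_pexp2l ?orbT.
  have lM : size x1 + k1 + 1 <= M.
    have lg : g k <= g k * Y by rewrite leq_pmulr.
    rewrite /M /B !mulnDl; rewrite /X in lXY; lia.
  have lt1M : t1 <= M by rewrite /M /B !mulnDl; lia.
  have M0 : 0 < M by apply: leq_trans lM; rewrite addn1.
  have lt2M : t2 <= c * M ^ e.
    apply: leq_trans lt2 _; rewrite leq_mul2l; apply/orP; right.
    by case: (e) => // e'; rewrite leq_exp2r.
  have -> : (37 * (c + 2)) * B k ^ e.+1 * X ^ (c1.+1 * e.+1) = 37 * (c + 2) * M ^ e.+1.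
    by rewrite expnM -/Y -mulnA -expnMn.
  have MM : M <= M ^ e.+1 by rewrite expnS leq_pmulr ?expn_gt0 ?M0.
  have Me : M ^ e <= M ^ e.+1 by rewrite leq_pexp2l.
  have lcM : c * M ^ e <= c * M ^ e.+1 by rewrite leq_mul2l Me orbT.
  rewrite mulnDr mulnDl -[37 * c * _]mulnA.
  move: (M ^ e.+1) (c * M ^ e) (c * M ^ e.+1) MM lcM lt2M => Z W U MM lcM lt2M.
  by move: lt3 lt4; rewrite /N; clear -lt2M lcM MM lM lt1M; lia.
- by rewrite p1.
Qed.

(** * Size of the instance and running time *)

Lemma size_flatten_le (A T : Type) (f : A -> seq T) s B :
  all (fun x => size (f x) <= B) s -> size (flatten (map f s)) <= size s * B.
Proof.
elim: s => //= x s IH /andP [l /IH h]; rewrite size_cat mulSn.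
exact: leq_add.
Qed.

Lemma size_enc_word_le w M : {in w, forall p, p.1 < M /\ p.2 < M} ->
  size (enc_word w) <= size w * M.*2.
Proof.
move=> h; apply: size_flatten_le; apply/allP => p /h [l1 l2].
rewrite /enc_pair size_cat !size_enc_nat; lia.
Qed.

(** * Bounds by powers of a common base *)

Section Pow.
Variable Z : nat.

Lemma pow0 : 1 <= Z ^ 0. Proof. by []. Qed.

Hypothesis base_gt1 : 1 < Z.

Lemma pow_le a i m : a <= Z ^ i -> i <= m -> a <= Z ^ m.
Proof. by move=> h l; apply: leq_trans h _; rewrite leq_exp2l. Qed.

(** A base of at least 2 absorbs a sum in one more unit of the exponent, so no coefficients have to
    be tracked. *)
Lemma pow_add a b i j m : a <= Z ^ i -> b <= Z ^ j -> i < m -> j < m -> a + b <= Z ^ m.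
Proof.
case: m => // m ha hb; rewrite !ltnS => li lj.
have h1 := pow_le ha li; have h2 := pow_le hb lj.
rewrite expnS; apply: leq_trans (leq_mul base_gt1 (leqnn _)).
by rewrite mul2n -addnn leq_add.
Qed.

Lemma pow_mul a b i j m : a <= Z ^ i -> b <= Z ^ j -> i + j <= m -> a * b <= Z ^ m.
Proof. by move=> ha hb; apply: pow_le; rewrite expnD leq_mul. Qed.

Lemma pow1 a : a <= Z -> a <= Z ^ 1. Proof. by rewrite expn1. Qed.

Lemma pow_dbl a i m : a <= Z ^ i -> i < m -> a.*2 <= Z ^ m.
Proof. by move=> h l; rewrite -addnn; apply: (pow_add h h). Qed.

Lemma pow_exp a i j m : a <= Z ^ i -> i * j <= m -> a ^ j <= Z ^ m.
Proof.
move=> h l; apply: (@pow_le _ (i * j)) l; rewrite expnM.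
by case: (j) => // j'; rewrite leq_exp2r.
Qed.

Lemma size_enc_words_le ws i j m :
  size ws <= Z ^ i -> {in ws, forall w, size (enc_word w) <= Z ^ j} ->
  i + j <= m -> size (enc_words ws) <= Z ^ m.
Proof.
move=> l1 l2 lm; apply: leq_trans (pow_mul l1 (leqnn (Z ^ j)) lm).
by apply: size_flatten_le; apply/allP.
Qed.

End Pow.

Lemma size_iter_extend j L T : size (iter j (extend L) T) = size L ^ j * size T.
Proof.
elim: j => [|j IH] /=; first by rewrite mul1n.
by rewrite size_rev size_allpairs IH mulnC expnS mulnA.
Qed.

Lemma enc_circuit_size C :
  inputs C + size (gates C) + 2 < size (enc_circuit C).
Proof.
have : forall gs, size gs <= size (flatten (map enc_gate gs)).
  elim=> //= g gs; rewrite size_cat /enc_gate /enc_pair /= size_cat size_enc_nat; lia.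
move=> /(_ (gates C)).
rewrite /enc_circuit /enc_pair /enc_seq /= !size_cat !size_enc_nat; lia.
Qed.

Lemma enc_circuit_preds C :
  all (fun g => size (preds g) < size (enc_circuit C)) (gates C).
Proof.
have h : forall gs, all (fun g => size (preds g) <= size (flatten (map enc_gate gs)))
  gs.
  elim=> //= g gs; rewrite size_cat => IH; apply/andP; split.
    rewrite /enc_gate /enc_pair /enc_seq /= !size_cat size_enc_nat.
    by rewrite !size_enc_nat; lia.
  by apply: sub_all IH => g' /leq_trans; apply; apply: leq_addl.
apply: sub_all (h (gates C)) => g l.
rewrite /enc_circuit /enc_pair /enc_seq /= !size_cat !size_enc_nat; lia.
Qed.

Section Bounds.
Variables (D k : nat) (C : circuit).
Let n := inputs C.
(** The summand [4 * D + 8] makes word lengths, variables and values all fit below the first power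
    of [Z]. *)
Let Z := size (enc_circuit C) + k + 4 * D + 8.

Lemma base_gt1 : 1 < Z. Proof. by rewrite /Z; lia. Qed.

Lemma inputs_le_base : n.+2 <= Z.
Proof. by have := enc_circuit_size C; rewrite /Z /n; lia. Qed.

Let ln1 := pow1 inputs_le_base.

Lemma size_segments_le : size (segments n.+1) <= Z ^ 2.
Proof.
apply: (@leq_trans (size (iota 1 n.+1) * n.+1)).
  apply: size_flatten_le; apply/allP => b; rewrite mem_iota size_map size_iota.
  by rewrite add1n ltnS => /andP [].
rewrite size_iota; have h := pow1 (ltnW inputs_le_base); exact: (pow_mul base_gt1 h h).
Qed.

Lemma enc_segments_size : size (enc_word (segments n.+1)) <= Z ^ 4.
Proof.
apply: leq_trans (size_enc_word_le (M := n.+2) _) _.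
  by case=> a b; rewrite mem_segments => /andP [l1 l2] /=; split; lia.
apply: (pow_mul base_gt1 size_segments_le); first exact: (pow_dbl base_gt1 ln1 (m :=
  2)).
by [].
Qed.

Lemma enc_steps_size : size (enc_word (steps k)) <= Z ^ 3.
Proof.
apply: leq_trans (size_enc_word_le (M := k.+2) _) _.
  by case=> a b; rewrite mem_steps /= => /andP [l /eqP ->]; split; lia.
have lk : k.+2 <= Z by rewrite /Z; lia.
rewrite size_map size_iota.
exact: (pow_mul base_gt1 (pow1 (ltnW lk)) (pow_dbl base_gt1 (pow1 lk) (m := 2) _)).
Qed.

Lemma enc_candidate_size j w : j <= D.*2 ->
  w \in iter j (extend (segments n.+1)) [:: [:: (n.+1, 0)]]
    -> size (enc_word w) <= Z ^ 3.
Proof.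
move=> lj /mem_iter_extend [ls [sl Ls ->]].
apply: leq_trans (size_enc_word_le (M := n.+2) _) _.
  case=> a b; rewrite mem_cat inE => /orP [/Ls|/eqP [-> ->] /=]; last by split; lia.
  by rewrite mem_segments => /andP [l1 l2] /=; split; lia.
apply: (pow_mul base_gt1 (i := 1)); last exact: leqnn;
  last exact: (pow_dbl base_gt1 ln1).
by rewrite size_cat sl /= /Z; lia.
Qed.

(** A candidate consists of at most [2D] segments, each chosen in at most [Z ^ 2] ways. *)
Lemma size_candidates_le j : j <= D.*2 ->
  size (iter j (extend (segments n.+1)) [:: [:: (n.+1, 0)]]) <= Z ^ (4 * D).
Proof.
move=> lj; rewrite size_iter_extend muln1.
by apply: (pow_exp base_gt1 size_segments_le); lia.
Qed.

Lemma enc_candidates_size j : j <= D.*2 ->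
  size (enc_words (iter j (extend (segments n.+1)) [:: [:: (n.+1, 0)]])) <= Z ^ (4 *
    D + 3).
Proof.
move=> lj; apply: (size_enc_words_le base_gt1 (size_candidates_le lj) _ (leqnn _)).
by move=> w; apply: enc_candidate_size.
Qed.

Lemma scopes_size j : j <= D ->
  size (iter j (extend (steps k)) [:: guess_word k D]) <= Z ^ D.
Proof.
move=> lj; rewrite size_iter_extend muln1 size_map size_iota.
by apply: (pow_exp base_gt1 (i := 1)); rewrite ?mul1n // expn1 /Z; lia.
Qed.

Lemma enc_scope_size j w : j <= D ->
  w \in iter j (extend (steps k)) [:: guess_word k D] -> size (enc_word w) <= Z ^ 3.
Proof.
move=> lj /mem_iter_extend [ls [sl Ls ->]].
have lM : red_vars D k <= Z by rewrite /red_vars /Z; lia.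
apply: leq_trans (size_enc_word_le (M := red_vars D k) _) _.
  case=> a b; rewrite mem_cat => /orP [/Ls|/guess_word_bound /= [l1 l2]]; last by [].
  by rewrite mem_steps /red_vars /= => /andP [l /eqP ->]; split; lia.
apply: (pow_mul base_gt1 (i := 1)); last exact: leqnn;
  last exact: (pow_dbl base_gt1 (pow1 lM)).
by rewrite size_cat sl size_guess_word /Z; lia.
Qed.

Lemma enc_scopes_size j : j <= D ->
  size (enc_words (iter j (extend (steps k)) [:: guess_word k D])) <= Z ^ (D + 3).
Proof.
move=> lj; apply: (size_enc_words_le base_gt1 (scopes_size lj) _ (leqnn _)).
by move=> w; apply: enc_scope_size.
Qed.

Lemma enc_rel_size : size (enc_rel D C) <= Z ^ (4 * D + 6).
Proof.
rewrite /enc_rel /red_rel /enc_seq size_cat size_enc_nat size_map.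
have cnt : size (good_words C (candidates D n)) <= Z ^ (4 * D).
  rewrite size_rev size_filter; apply: leq_trans (count_size _ _) _.
  exact: size_candidates_le.
apply: (pow_add base_gt1 (i := 4 * D + 1) (j := 4 * D + 4)); try lia.
  rewrite -addn1; apply: (pow_add base_gt1 cnt (pow0 Z)); lia.
rewrite -map_comp.
have h : all (fun w => size ((enc_seq enc_nat \o unpair) w) <= Z ^ 4) (good_words C
  (candidates D n)).
  apply/allP => w; rewrite mem_rev mem_filter => /andP [_ wt] /=.
  rewrite enc_seq_unpair size_cat size_enc_nat (size_candidate wt).
  apply: (pow_add base_gt1 (i := 1) (j := 3)) => //;
    last exact: (enc_candidate_size (leqnn _) wt).
  by rewrite expn1 /Z; lia.
exact: leq_trans (size_flatten_le h) (pow_mul base_gt1 cnt (leqnn _) (leqnn _)).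
Qed.

Lemma enc_nbs_size : size (enc_nbs D k) <= Z ^ 3.
Proof.
have lM : (red_vars D k).+1 <= Z by rewrite /red_vars /Z; lia.
rewrite /enc_nbs /enc_seq size_cat size_enc_nat size_iota.
apply: (pow_add base_gt1 (i := 1) (j := 2)) => //.
have h : all (fun v => size (enc_nat v) <= Z) (iota 0 (red_vars D k)).
  by apply/allP => v; rewrite mem_iota size_enc_nat; lia.
apply: leq_trans (size_flatten_le h) _; rewrite size_iota.
exact: (pow_mul base_gt1 (pow1 (ltnW lM)) (pow1 (leqnn Z))).
Qed.

(** The main term is [Z ^ D] constraints of size [Z ^ (4 * D + 7)] each; the rest of the exponent is
    room for adding up the six components. *)
Lemma red_size :
  size (enc_csp_bigraph (red_csp D C k, red_nb D k)) <= Z ^ (5 * D + 14).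
Proof.
have lM : (red_vars D k).+1 <= Z by rewrite /red_vars /Z; lia.
have ln3 : n.+3 <= Z by have := enc_circuit_size C; rewrite /Z /n; lia.
have cnt : size (scopes D k) <= Z ^ D by apply: scopes_size.
have cnt1 : (size (scopes D k)).+1 <= Z ^ D.+1.
  by rewrite -addn1; apply: (pow_add base_gt1 cnt (pow0 Z)).
rewrite enc_redE !size_cat !size_enc_nat.
have l1 : size (flatten [seq enc_seq enc_nat (unpair w) ++ enc_rel D C | w <- rev
  (scopes D k)])
    <= Z ^ (5 * D + 7).
  have h : all (fun w => size (enc_seq enc_nat (unpair w) ++ enc_rel D C) <= Z ^ (4 *
    D + 7))
      (rev (scopes D k)).
    apply/allP => w; rewrite mem_rev => ws.
    rewrite size_cat enc_seq_unpair size_cat size_enc_nat (size_scope ws).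
    apply: (pow_add base_gt1 (i := 4) (j := 4 * D + 6)); try lia;
      last exact: enc_rel_size.
    apply: (pow_add base_gt1 (i := 1) (j := 3)) => //;
      last exact: (enc_scope_size (leqnn _) ws).
    by rewrite expn1 /Z; lia.
  apply: leq_trans (size_flatten_le h) _; rewrite size_rev.
  by apply: (pow_mul base_gt1 cnt (leqnn _)); lia.
have l2 : size (flatten (nseq (size (scopes D k)) (enc_nbs D k))) <= Z ^ (D + 3).
  have h : all (fun w => size (id w) <= Z ^ 3) (nseq (size (scopes D k)) (enc_nbs D k)).
    by apply/allP => w /nseqP [-> _]; apply: enc_nbs_size.
  have := size_flatten_le h; rewrite map_id size_nseq => /leq_trans; apply.
  exact: (pow_mul base_gt1 cnt (leqnn _)).
apply: (pow_add base_gt1 (pow1 lM) (j := 5 * D + 13)); try lia.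
apply: (pow_add base_gt1 (pow1 ln3) (j := 5 * D + 12)); try lia.
apply: (pow_add base_gt1 cnt1 (j := 5 * D + 11)); try lia.
apply: (pow_add base_gt1 l1 (j := 5 * D + 10)); try lia.
by apply: (pow_add base_gt1 cnt1 l2); lia.
Qed.

End Bounds.

Lemma wcs_reduction (R : realType) d : exists q c e a, forall x k,
  instance (weighted_circuit_sat 1 d) x k -> exists t s x' k',
     [/\ exec q (init x (unary k)) t s, s 0 = x' /\ s 1 = unary k',
         t <= c * (size x + k + 1) ^ e /\ k' <= k + a,
         instance (csp_near_interval_bigraph R) x' k' &
         positive (weighted_circuit_sat 1 d) x k <->
         positive (csp_near_interval_bigraph R) x' k'].
Proof.
(* The program, and with it the degree of its running time, depends on the depth [d] only. *)
pose D := 2 ^ d; have [c [e hT]] := max_time_poly (reduction_prog D).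
pose E := 5 * D + 14; pose m := 4 * D + 8.
exists (reduction_prog D), (c * (m ^ E.+1) ^ e), (E.+1 * e), (D.*2.+2) =>
  x k [C [-> [wfC w1 dC]]].
have D0 : 0 < D by rewrite expn_gt0.
have dD : 2 ^ depth C <= D by rewrite leq_exp2l.
pose Z := size (enc_circuit C) + k + 4 * D + 8.
have base_gt1 : 1 < Z by rewrite /Z; lia.
pose N := Z ^ E.
have lZ i a : i <= E -> a <= Z ^ i -> a <= N by move=> l h; apply: pow_le h l.
have lX : size (enc_circuit C) <= Z by rewrite /Z; lia.
have [||||||||||s [t ex lt] [e0 e1]] := @run_reduction N D C k wfC.
- apply: (lZ 2); [rewrite /E; lia | apply: (pow_dbl base_gt1 (i := 1)) => //].
  by have := enc_circuit_size C; move: lX; rewrite expn1; lia.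
- apply: sub_all (enc_circuit_preds C) => g l.
  by apply: (lZ 1); [rewrite /E; lia | exact: leq_trans l lX].
- by apply: (lZ 1); [rewrite /E; lia | exact: lX].
- by apply: (lZ 4); [rewrite /E; lia | apply: enc_segments_size].
- by apply: (lZ 3); [rewrite /E; lia | apply: enc_steps_size].
- by move=> j lj; apply: (lZ (4 * D + 3)); [rewrite /E;
  lia | apply: enc_candidates_size].
- by move=> j lj; apply: (lZ (D + 3)); [rewrite /E; lia | apply: enc_scopes_size].
- by apply: (lZ (4 * D + 6)); [rewrite /E; lia | apply: enc_rel_size].
- by apply: (lZ 3); [rewrite /E; lia | apply: enc_nbs_size].
- by apply: (lZ E) => //; apply: red_size.
have equiv : (exists a, [/\ size a = inputs C, count id a = k & eval C a]) <->
    satisfiable (red_csp D C k).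
  split=> [[a [sa ca ea]]|]; first exact: (csp_complete D0 wfC w1 dD sa ca ea).
  exact: csp_sound.
have inst : let G' := @bigraph_of (Defs.ncons (red_csp D C k)) (nvars (red_csp D C
  k)) (red_nb D k) in
   [/\ wf_csp (red_csp D C k),
     wf_bigraph (Defs.ncons (red_csp D C k)) (nvars (red_csp D C k)) (red_nb D k),
     interval_bigraph R G' & adds_at_most (red_vars D k) (@incidence (red_csp D C k))
       G'].
  split; [exact: red_wf_csp | exact: red_wf_bigraph | exact: red_interval | exact:
    red_adds].
exists t, s, (enc_csp_bigraph (red_csp D C k, red_nb D k)), (red_vars D k).
split=> //.
- split; last by rewrite /red_vars.
  apply: leq_trans lt _; apply: leq_trans (hT N) _; rewrite -mulnA leq_mul2l;
    apply/orP; right.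
  rewrite expnM -expnMn.
  (* [Z] is at most [m] times the input size, and [N.+1] is at most [Z ^ E.+1]. *)
  suff h : N.+1 <= m ^ E.+1 * (size (enc_circuit C) + k + 1) ^ E.+1.
    by case: (e) => // e'; rewrite leq_exp2r.
  rewrite -expnMn; apply: (@leq_trans (Z ^ E.+1)).
    by rewrite -addn1; apply: (pow_add base_gt1 (leqnn _) (pow0 Z)).
  by rewrite leq_exp2r // /Z /m; lia.
- by exists (red_csp D C k, red_nb D k).
(* Being positive quantifies over all decodings of the string; injectivity leaves only the intended
   one. *)
split=> [[C' [/enc_circuit_inj <- _ /equiv h]]|[[P nb] [/enc_csp_bigraph_inj [<- _]
  _ /equiv h]]].
  by exists (red_csp D C k, red_nb D k).
by exists C.
Qed.

Theorem theorem10 (R : realType) : W_hard 1 (csp_near_interval_bigraph R).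
Proof.
move=> P [d d0 red]; have [q [c [e [a h]]]] := wcs_reduction R d.
exact: fpt_reducible_poly h red.
Qed.
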